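(* Let $\psi\in L^2(\mathbb R)$ be admissible with constant $C_\psi$, and let $f,g\in L^2(\mathbb R)$. Then the novel special affine wavelet transforms of $f$ and $g$ with respect to $\psi$ satisfy $$\int_{\mathbb R\times\mathbb R^+}\mathcal A^{\psi}_{\Lambda_S}[f](t,\zeta)\,\big(\mathcal A^{\psi}_{\Lambda_S}[g](t,\zeta)\big)^*\,\frac{dt\,d\zeta}{\zeta^2}=C_\psi\,\langle f,g\rangle_{L^2(\mathbb R)}.$$
   Context: Fix real parameters $A,B,C,D,p,q$ with $AD-BC=1$ and $B\neq0$ (collected in $\Lambda_S$). $z^*$ denotes the complex conjugate of $z$, $\langle f,g\rangle=\int_{\mathbb R} f g^*\,dx$, and $\mathbb R^+=(0,\infty)$. Put $K_B=\frac1{\sqrt{2\pi B}}$ (principal square root) and $$\mathcal K_{\Lambda_S}(x,\omega)=K_B^*\exp\left\{\frac{i}{2B}\big(Ax^2+2x(p-\omega)-2\omega(Dp-Bq)+D\omega^2\big)\right\}.$$ The special affine Fourier transform (SAFT) is $\widehat f_{\Lambda_S}(\omega)=\int_{\mathbb R}f(x)\mathcal K_{\Lambda_S}(x,\omega)\,dx$ for $f\in L^1(\mathbb R)\cap L^2(\mathbb R)$, extended to a unitary operator on $L^2(\mathbb R)$. For $\psi\in L^2(\mathbb R)$, $t\in\mathbb R$, $\zeta>0$, put $$\psi^{\Lambda_S}_{t,\zeta}(x)=\frac{K_B}{\sqrt\zeta}\,\psi\left(\frac{x-t}{\zeta}\right)\exp\left\{\frac{iAx(t-x)}{B}\right\}.$$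 The novel special affine wavelet transform of $f\in L^2(\mathbb R)$ is $\mathcal A^{\psi}_{\Lambda_S}[f](t,\zeta)=\int_{\mathbb R}f(x)\,\big(\psi^{\Lambda_S}_{t,\zeta}(x)\big)^*dx$. Let $\Psi(x,\zeta)=\exp\left\{\frac{i}{2B}\big(Ax^2(\zeta^2-1)+2xp(\zeta-1)\big)\right\}\psi^*(-x)$ and let $\widehat\Psi_{\Lambda_S}(\zeta\omega,\zeta)$ denote the SAFT of $x\mapsto\Psi(x,\zeta)$ evaluated at $\zeta\omega$. The function $\psi$ is called admissible if there is a constant $C_\psi$ with $0<C_\psi<\infty$ such that $$\int_{\mathbb R^+}\frac{|\widehat\Psi_{\Lambda_S}(\zeta\omega,\zeta)|^2}{\zeta}\,d\zeta=C_\psi\quad\text{for a.e. }\omega\in\mathbb R.$$ *)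

(* Defs.v *)
From mathcomp Require Import all_boot all_order all_algebra.
From mathcomp Require Import all_classical all_reals all_analysis.
From mathcomp Require Import complex.
Import Order.TTheory GRing.Theory Num.Theory numFieldNormedType.Exports.

Set Implicit Arguments.
Unset Strict Implicit.
Unset Printing Implicit Defensive.

Local Open Scope classical_set_scope.
Local Open Scope ring_scope.
Local Open Scope complex_scope.

Notation normc := ComplexField.Normc.normc.

Section complex_integration.
Context (d : measure_display) (T : measurableType d) (R : realType).
Variable mu : {measure set T -> \bar R}.
Implicit Types (D : set T) (f : T -> R[i]).

Definition cmeasurable D f : Prop :=
  measurable_fun D (fun x => complex.Re (f x)) /\ measurable_fun D (fun x => complex.Im (f x)).

Definition cintegrable D f : Prop :=
  mu.-integrable D (fun x => (complex.Re (f x))%:E) /\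
  mu.-integrable D (fun x => (complex.Im (f x))%:E).

Definition cintegral D f : R[i] :=
  Rintegral mu D (fun x => complex.Re (f x)) +i* Rintegral mu D (fun x => complex.Im (f x)).

Definition cLnorm (p : \bar R) f : \bar R :=
  Lnorm mu p (fun x => (normc (f x))%:E).

(* Membership in the complex L^p space; elements are functions, not classes. *)
Definition cLp (p : \bar R) f : Prop := cmeasurable setT f /\ (cLnorm p f < +oo)%E.

Definition cLp_cvg (p : \bar R) (u : nat -> T -> R[i]) f : Prop :=
  (fun n => cLnorm p (fun x => u n x - f x)) @ \oo --> 0%E.

End complex_integration.

Definition half_plane (R : realType) : set (measurableTypeR R * measurableTypeR R) :=
  [set u | 0 < (u.2 : R)].
Arguments half_plane : clear implicits.

Section saft.
Context (R : realType).
Implicit Types (f g psi F : R -> R[i]).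

Local Notation mu := (@lebesgue_measure R).
Local Notation L1 f := (cLp mu 1%:E f).
Local Notation L2 f := (cLp mu 2%:E f).

(* exp (i theta) for real theta *)
Definition expi (theta : R) : R[i] := cos theta +i* sin theta.

Definition inner_L2 f g : R[i] := cintegral mu setT (fun x => f x * conjc (g x)).

(* [sqrtc] is the principal square root, so this also covers B < 0. *)
Definition K_B (B : R) : R[i] := (sqrtc (2 * pi * B)%:C)^-1.

Definition saft_kernel (A B D p q x w : R) : R[i] :=
  conjc (K_B B) *
  expi ((2 * B)^-1 *
    (A * x ^+ 2 + 2 * x * (p - w) - 2 * w * (D * p - B * q) + D * w ^+ 2)).

Definition saft_integral (A B D p q : R) f (w : R) : R[i] :=
  cintegral mu setT (fun x => f x * saft_kernel A B D p q x w).

(* F represents the image of f under the extension to L^2 of the integral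
   transform on L^1 /\ L^2: as that transform is isometric for the L^2 norm and
   L^1 /\ L^2 is dense, F is unique up to a null set. *)
Definition is_saft (A B D p q : R) f F : Prop :=
  [/\ L2 f, L2 F &
    exists u : nat -> R -> R[i],
      [/\ forall n, L1 (u n) /\ L2 (u n),
          cLp_cvg mu 2%:E u f &
          cLp_cvg mu 2%:E (fun n => saft_integral A B D p q (u n)) F]].

Definition sa_wavelet (A B : R) psi (t zeta x : R) : R[i] :=
  K_B B / (Num.sqrt zeta)%:C * psi ((x - t) / zeta) *
  expi (A * x * (t - x) / B).

Definition sawt (A B : R) psi f (t zeta : R) : R[i] :=
  cintegral mu setT (fun x => f x * conjc (sa_wavelet A B psi t zeta x)).

Definition Psi (A B p : R) psi (x zeta : R) : R[i] :=
  expi ((2 * B)^-1 * (A * x ^+ 2 * (zeta ^+ 2 - 1) + 2 * x * p * (zeta - 1))) *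
  conjc (psi (- x)).

(* For each zeta > 0 the transform of Psi(., zeta) is only an L^2 class, whereas
   the admissibility integral runs over zeta at fixed omega.  It is computed on
   a jointly measurable choice (omega, zeta) |-> H omega zeta of
   representatives; two such choices give the same integral for almost every
   omega. *)
Definition admissible (A B D p q : R) psi (Cpsi : R) : Prop :=
  0 < Cpsi /\
  exists H : R -> R -> R[i],
    [/\ cmeasurable (half_plane R) (fun u => H u.1 u.2),
        forall zeta : R, 0 < zeta ->
          is_saft A B D p q (fun x => Psi A B p psi x zeta) (H ^~ zeta) &
        {ae mu, forall w : R,
          (\int[mu]_(zeta in `]0%R, +oo[)
             (normc (H (zeta * w) zeta) ^+ 2 / zeta)%:E = Cpsi%:E)%E}].

End saft.

(* Main.v *)
(* The chirp exp (i (A x^2 + 2 p x) / (2 B)) turns the SAFT into the Fourier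
   transform and, for a fixed scale zeta, the wavelet transform of f into the
   convolution of the chirped f with a dilated chirped Psi(., zeta).  Plancherel
   in t then replaces that convolution by a product of transforms, and Tonelli
   with the admissibility condition gives
     int |A[f](t, zeta)|^2 dt dzeta / zeta^2 = C_psi ||f||^2
   for f in L^1 /\ L^2.  This isometry extends to L^2 because an L^2 limit of f
   is a pointwise limit of A[f], and polarization gives the inner products.
   Plancherel itself is obtained by pairing the autocorrelation of f with
   the Poisson kernel. *)
Require Import Defs.
From mathcomp Require Import all_boot all_order all_algebra.
From mathcomp Require Import all_classical all_reals all_analysis.
From mathcomp Require Import measurable_realfun complex ring lra.
Import Order.TTheory GRing.Theory Num.Theory numFieldNormedType.Exports.

Set Implicit Arguments.
Unset Strict Implicit.
Unset Printing Implicit Defensive.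

Local Open Scope classical_set_scope.
Local Open Scope ring_scope.
Local Open Scope complex_scope.

(** The obstacle is that [Psi(., zeta)] lies only in L^2 and its transform is given as an L^2 limit,
    while [fourier] is an integral over integrable functions. Each norm identity is therefore proved
    on L^1 /\ L^2 and carried over by [cLnorm2_pointwise_isometry], once for [Psi(., zeta)] at a
    fixed scale and once for [f]. Cauchy-Schwarz makes this possible: the value of a convolution or
    of a wavelet transform at a single point depends continuously on L^2 data. In Plancherel, the
    weight [exp (- e |w|)] increases to 1 as [e] decreases, so monotone convergence yields the
    energy of the transform without knowing beforehand that it is finite. The other side needs the
    autocorrelation to be continuous at 0, that is, continuity of translations in L^2. The constants
    cancel as follows: Plancherel contributes [2 * pi], the frequency [w / B] contributes [|B|], and
    [|K_B|^2] is the inverse of their product. At scale [zeta] a factor [zeta] meets the weight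
    [zeta^-2], which leaves the [1 / zeta] of the admissibility condition. *)

Section complex_numbers.
Context (R : realType).
Implicit Types (x y : R) (z w : R[i]).

Lemma ReM z w : complex.Re (z * w) = complex.Re z * complex.Re w - complex.Im z * complex.Im w.
Proof. by case: z w => [a b] [c d]. Qed.

Lemma ImM z w : complex.Im (z * w) = complex.Re z * complex.Im w + complex.Im z * complex.Re w.
Proof. by case: z w => [a b] [c d]. Qed.

Lemma ReD z w : complex.Re (z + w) = complex.Re z + complex.Re w.
Proof. by case: z w => [a b] [c d]. Qed.

Lemma ImD z w : complex.Im (z + w) = complex.Im z + complex.Im w.
Proof. by case: z w => [a b] [c d]. Qed.

Lemma ReN z : complex.Re (- z) = - complex.Re z.
Proof. by case: z. Qed.

Lemma ImN z : complex.Im (- z) = - complex.Im z.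
Proof. by case: z. Qed.

Lemma ReJ z : complex.Re (conjc z) = complex.Re z.
Proof. by case: z. Qed.

Lemma ImJ z : complex.Im (conjc z) = - complex.Im z.
Proof. by case: z. Qed.

Definition ReImE := (ReM, ImM, ReD, ImD, ReN, ImN, ReJ, ImJ).

Lemma complexP z w : complex.Re z = complex.Re w -> complex.Im z = complex.Im w -> z = w.
Proof. by case: z w => [a b] [c d] /= -> ->. Qed.

Lemma sqr_normc z : normc z ^+ 2 = complex.Re z ^+ 2 + complex.Im z ^+ 2.
Proof. by case: z => a b /=; rewrite sqr_sqrtr// addr_ge0// sqr_ge0. Qed.

Lemma normc_ge0 z : 0 <= normc z.
Proof. by case: z => a b; exact: sqrtr_ge0. Qed.

Lemma normc_conjc z : normc (conjc z) = normc z.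
Proof. by case: z => a b /=; rewrite sqrrN. Qed.

Lemma normc_real x : normc x%:C = `|x|.
Proof. by rewrite /= expr0n/= addr0 sqrtr_sqr. Qed.

Lemma conjcM z w : conjc (z * w) = conjc z * conjc w.
Proof. by apply: complexP; rewrite !ReImE; ring. Qed.

Lemma mulcJ z : z * conjc z = (normc z ^+ 2)%:C.
Proof. by rewrite sqr_normc; apply: complexP; rewrite !ReImE/=; ring. Qed.

Lemma ler_Re_normc z : `|complex.Re z| <= normc z.
Proof.
by rewrite -ler_sqr ?nnegrE ?normc_ge0// ?real_normK ?num_real// sqr_normc lerDl sqr_ge0.
Qed.

Lemma ler_Im_normc z : `|complex.Im z| <= normc z.
Proof.
by rewrite -ler_sqr ?nnegrE ?normc_ge0// ?real_normK ?num_real// sqr_normc lerDr sqr_ge0.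
Qed.

Lemma normc_leD z : normc z <= `|complex.Re z| + `|complex.Im z|.
Proof.
rewrite -ler_sqr ?nnegrE ?normc_ge0 ?addr_ge0// sqr_normc sqrrD !real_normK ?num_real//.
by rewrite addrAC lerDl mulrn_wge0// mulr_ge0.
Qed.

Lemma ler_dist_normc z w : `|normc z - normc w| <= normc (z - w).
Proof.
have h z' w' : normc z' - normc w' <= normc (z' - w').
  by rewrite lerBlDr -{1}(subrK w' z') le_normcD.
rewrite ler_norml h andbT lerNl opprB.
by apply: le_trans (h _ _) _; rewrite -normcN opprB.
Qed.

Lemma expiD x y : expi (x + y) = expi x * expi y.
Proof. by apply: complexP; rewrite !ReImE/= ?cosD ?sinD//; ring. Qed.

Lemma expiN x : expi (- x) = conjc (expi x).
Proof. by rewrite /expi cosN sinN. Qed.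

Lemma normc_expi x : normc (expi x) = 1.
Proof. by rewrite /expi /= cos2Dsin2 sqrtr1. Qed.

(** Since [Re (z * conjc ('i * w)) = Im (z * conjc w)], both components are differences of real
    energies, which can be integrated as real functions. *)
Lemma normc_polarization z w :
  4%:R * (z * conjc w) = (normc (z + w) ^+ 2 - normc (z - w) ^+ 2) +i*
   (normc (z + 'i * w) ^+ 2 - normc (z - 'i * w) ^+ 2).
Proof.
apply: complexP; rewrite !sqr_normc mulr_natl ?raddfMn/= !ReImE/= ?mulr2n.
all: case: z w => [a b] [c d]; rewrite /= ?ReImE /=; ring.
Qed.

End complex_numbers.

(** * Measurability of complex-valued functions *)

Lemma measurableEFin (d : measure_display) (T : measurableType d) (R : realType)
    (D : set T) (r : T -> R) :
  measurable_fun D r -> measurable_fun D (fun x => (r x)%:E).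
Proof. by move=> ?; exact/measurable_EFinP. Qed.

Section complex_measurability.
Context (d : measure_display) (T : measurableType d) (R : realType).
Implicit Types (D : set T) (f g : T -> R[i]).

Lemma cmeasurableD D f g : cmeasurable D f -> cmeasurable D g ->
  cmeasurable D (fun x => f x + g x).
Proof.
move=> [f1 f2] [g1 g2]; split.
- by under eq_fun do rewrite ReD; exact: measurable_funD.
- by under eq_fun do rewrite ImD; exact: measurable_funD.
Qed.

Lemma cmeasurableN D f : cmeasurable D f -> cmeasurable D (fun x => - f x).
Proof.
move=> [f1 f2]; split.
- by under eq_fun do rewrite ReN; exact: measurable_funN.
- by under eq_fun do rewrite ImN; exact: measurable_funN.
Qed.

Lemma cmeasurableB D f g : cmeasurable D f -> cmeasurable D g ->
  cmeasurable D (fun x => f x - g x).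
Proof. by move=> mf mg; apply: cmeasurableD => //; exact: cmeasurableN. Qed.

Lemma cmeasurableM D f g : cmeasurable D f -> cmeasurable D g ->
  cmeasurable D (fun x => f x * g x).
Proof.
move=> [f1 f2] [g1 g2]; split.
- by under eq_fun do rewrite ReM; apply: measurable_funB; exact: measurable_funM.
- by under eq_fun do rewrite ImM; apply: measurable_funD; exact: measurable_funM.
Qed.

Lemma cmeasurableJ D f : cmeasurable D f -> cmeasurable D (fun x => conjc (f x)).
Proof.
move=> [f1 f2]; split.
- by under eq_fun do rewrite ReJ.
- by under eq_fun do rewrite ImJ; exact: measurable_funN.
Qed.

Lemma cmeasurable_cst D (z : R[i]) : cmeasurable D (fun=> z).
Proof. by split; exact: measurable_cst. Qed.

Lemma cmeasurable_realC D (r : T -> R) : measurable_fun D r ->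
  cmeasurable D (fun x => (r x)%:C).
Proof. by move=> mr; split => //; exact: measurable_cst. Qed.

Lemma cmeasurable_expi D (r : T -> R) : measurable_fun D r ->
  cmeasurable D (fun x => expi (r x)).
Proof.
move=> mr; split.
- by apply: measurableT_comp => //; apply: continuous_measurable_fun => x; exact: continuous_cos.
- by apply: measurableT_comp => //; apply: continuous_measurable_fun => x; exact: continuous_sin.
Qed.

Lemma measurable_normc_sqr D f : cmeasurable D f ->
  measurable_fun D (fun x => normc (f x) ^+ 2).
Proof.
move=> [f1 f2]; under eq_fun do rewrite sqr_normc.
by apply: measurable_funD; exact: measurable_funX.
Qed.

Lemma measurable_normc D f : cmeasurable D f ->
  measurable_fun D (fun x => normc (f x)).
Proof.
move=> mf; rewrite [X in measurable_fun _ X](_ : _ = (@Num.sqrt R) \o (fun x => normc (f x) ^+ 2)); last first.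
  by apply/funext => x /=; rewrite sqrtr_sqr ger0_norm ?normc_ge0.
apply: measurableT_comp; last exact: measurable_normc_sqr.
by apply: continuous_measurable_fun => x; exact: sqrt_continuous.
Qed.

Lemma measurable_normcE D f : cmeasurable D f ->
  measurable_fun D (fun x => (normc (f x))%:E).
Proof. by move=> mf; apply/measurable_EFinP; exact: measurable_normc. Qed.

Lemma measurable_normc_sqrE D f : cmeasurable D f ->
  measurable_fun D (fun x => (normc (f x) ^+ 2)%:E).
Proof. by move=> mf; apply/measurable_EFinP; exact: measurable_normc_sqr. Qed.

End complex_measurability.

Lemma cmeasurableT_comp d1 d2 (T1 : measurableType d1) (T2 : measurableType d2)
    (R : realType) (f : T2 -> R[i]) (g : T1 -> T2) :
  cmeasurable setT f -> measurable_fun setT g -> cmeasurable setT (fun x => f (g x)).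
Proof. by move=> [f1 f2] mg; split; [exact: (measurableT_comp f1)|exact: (measurableT_comp f2)]. Qed.

(** * Integrability and linearity of the complex integral *)

Section complex_integral.
Context (d : measure_display) (T : measurableType d) (R : realType).
Variable mu : {measure set T -> \bar R}.
Variables (D : set T) (mD : measurable D).
Implicit Types (f g : T -> R[i]).

Lemma cintegrable_cmeasurable f : cintegrable mu D f -> cmeasurable D f.
Proof.
by move=> [/measurable_int/measurable_EFinP ? /measurable_int/measurable_EFinP ?]; split.
Qed.

Lemma le_cintegrable f (g : T -> R) : cmeasurable D f ->
  (forall x, D x -> normc (f x) <= g x) -> mu.-integrable D (EFin \o g) ->
  cintegrable mu D f.
Proof.
move=> [f1 f2] fg ig; split; apply: le_integrable ig => //; try exact/measurable_EFinP.
- move=> x Dx /=; rewrite lee_fin (le_trans (ler_Re_normc _))// (le_trans (fg _ Dx))//.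
  exact: ler_norm.
- move=> x Dx /=; rewrite lee_fin (le_trans (ler_Im_normc _))// (le_trans (fg _ Dx))//.
  exact: ler_norm.
Qed.

Lemma cintegrable_normc f : cintegrable mu D f -> mu.-integrable D (fun x => (normc (f x))%:E).
Proof.
move=> [f1 f2]; have mf := cintegrable_cmeasurable (conj f1 f2).
apply: (le_integrable _ _ _ (integrableD mD (integrable_abse f1) (integrable_abse f2))) => //.
  exact: measurable_normcE.
move=> x Dx /=; rewrite lee_fin ger0_norm ?normc_ge0// ger0_norm ?addr_ge0//.
exact: normc_leD.
Qed.

(** Reduces integrability to the finiteness of one nonnegative integral, the form that Tonelli and
    Cauchy-Schwarz deliver. *)
Lemma cintegrableP f : cintegrable mu D f <->
  cmeasurable D f /\ (\int[mu]_(x in D) (normc (f x))%:E < +oo)%E.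
Proof.
split=> [if_|[mf fy]].
  split; first exact: cintegrable_cmeasurable.
  exact/integrable_lty/cintegrable_normc.
apply: (le_cintegrable mf (fun x _ => lexx _)); apply/integrableP; split.
  exact: measurable_normcE.
by under eq_integral do rewrite /= ger0_norm ?normc_ge0//.
Qed.

Lemma cintegrableD f g : cintegrable mu D f -> cintegrable mu D g ->
  cintegrable mu D (fun x => f x + g x).
Proof.
move=> [f1 f2] [g1 g2]; split.
- by under eq_fun do rewrite ReD; exact: (integrableD mD f1 g1).
- by under eq_fun do rewrite ImD; exact: (integrableD mD f2 g2).
Qed.

Lemma cintegrableM_bounded f g (M : R) : cintegrable mu D f -> cmeasurable D g ->
  (forall x, D x -> normc (g x) <= M) -> cintegrable mu D (fun x => f x * g x).
Proof.
move=> if_ mg gM; have mf := cintegrable_cmeasurable if_.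
apply: (le_cintegrable (g := fun x => M * normc (f x)) (cmeasurableM mf mg)).
  by move=> x Dx; rewrite ComplexField.Normc.normcM mulrC ler_wpM2r ?normc_ge0 ?gM.
have := integrableZl mD M (cintegrable_normc if_).
by apply: eq_integrable => // x _ /=; rewrite EFinM.
Qed.

Lemma cintegrableZ f (c : R[i]) : cintegrable mu D f -> cintegrable mu D (fun x => c * f x).
Proof.
move=> if_; under eq_fun do rewrite mulrC.
by apply: (cintegrableM_bounded if_ (cmeasurable_cst _ c)) => // x _; exact: lexx.
Qed.

Lemma cintegrableN f : cintegrable mu D f -> cintegrable mu D (fun x => - f x).
Proof. by move=> if_; under eq_fun do rewrite -mulN1r; exact: cintegrableZ. Qed.

Lemma cintegrableB f g : cintegrable mu D f -> cintegrable mu D g ->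
  cintegrable mu D (fun x => f x - g x).
Proof. by move=> if_ ig; apply: cintegrableD => //; exact: cintegrableN. Qed.

Lemma cintegrableJ f : cintegrable mu D f -> cintegrable mu D (fun x => conjc (f x)).
Proof.
move=> [f1 f2]; split.
- by under eq_fun do rewrite ReJ.
- by under eq_fun do rewrite ImJ; exact: (integrableN f2).
Qed.

Lemma eq_cintegral f g : {in D, f =1 g} -> cintegral mu D f = cintegral mu D g.
Proof.
by move=> fg; congr (_ +i* _); apply: eq_Rintegral => x Dx; rewrite fg.
Qed.

Lemma cintegralD f g : cintegrable mu D f -> cintegrable mu D g ->
  cintegral mu D (fun x => f x + g x) = cintegral mu D f + cintegral mu D g.
Proof.
move=> [f1 f2] [g1 g2]; apply: complexP; rewrite ?ReImE/=.
- by under eq_Rintegral do rewrite ReD; rewrite RintegralD.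
- by under eq_Rintegral do rewrite ImD; rewrite RintegralD.
Qed.

Lemma cintegralZ f (c : R[i]) : cintegrable mu D f ->
  cintegral mu D (fun x => c * f x) = c * cintegral mu D f.
Proof.
move=> [f1 f2].
have h (k : R) (u : T -> R) : mu.-integrable D (EFin \o u) ->
    mu.-integrable D (EFin \o (fun x => k * u x)).
  move=> iu; have := integrableZl mD k iu.
  by apply: eq_integrable => // x _ /=; rewrite EFinM.
apply: complexP; rewrite ?ReImE/=.
- under eq_Rintegral do rewrite ReM.
  by rewrite RintegralB ?RintegralZl//; exact: h.
- under eq_Rintegral do rewrite ImM.
  by rewrite RintegralD ?RintegralZl//; exact: h.
Qed.

Lemma cintegralB f g : cintegrable mu D f -> cintegrable mu D g ->
  cintegral mu D (fun x => f x - g x) = cintegral mu D f - cintegral mu D g.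
Proof.
move=> if_ ig; rewrite cintegralD//; last exact: cintegrableN.
congr (_ + _); under [LHS]eq_cintegral do rewrite -mulN1r.
by rewrite cintegralZ// mulN1r.
Qed.

Lemma cintegralJ f : cintegrable mu D f ->
  cintegral mu D (fun x => conjc (f x)) = conjc (cintegral mu D f).
Proof.
move=> [f1 f2]; apply: complexP; rewrite ?ReImE/=.
- by under eq_Rintegral do rewrite ReJ.
- under eq_Rintegral do rewrite ImJ -mulN1r.
  by rewrite RintegralZl// mulN1r.
Qed.

(* After rotation by the phase of the integral, the integral is a real part. *)
Lemma normc_cintegral_le f : cintegrable mu D f ->
  ((normc (cintegral mu D f))%:E <= \int[mu]_(x in D) (normc (f x))%:E)%E.
Proof.
move=> if_; set z := cintegral _ _ _.
have [->|z0] := eqVneq z 0.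
  by rewrite ComplexField.Normc.normc0 integral_ge0// => x _; rewrite lee_fin normc_ge0.
have nz0 : 0 < normc z.
  rewrite lt_neqAle normc_ge0 andbT eq_sym; apply: contra z0 => /eqP.
  by move/ComplexField.Normc.eq0_normc => ->.
have in_ := cintegrable_normc if_.
have fin := integrable_fin_num mD in_.
have [iz _] := cintegrableZ (conjc z) if_.
have : (normc z ^+ 2 = complex.Re (cintegral mu D (fun x => conjc z * f x)))%R.
  by rewrite cintegralZ// mulrC mulcJ.
have : complex.Re (cintegral mu D (fun x => conjc z * f x)) <=
    normc z * Rintegral mu D (fun x => normc (f x)).
  rewrite -RintegralZl// -[leLHS]/(Rintegral mu D (fun x => complex.Re (conjc z * f x))).
  apply: le_Rintegral => //.
    have := integrableZl mD (normc z) in_.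
    by apply: eq_integrable => // x _ /=; rewrite EFinM.
  move=> x _; rewrite (le_trans (ler_norm _))// (le_trans (ler_Re_normc _))//.
  by rewrite ComplexField.Normc.normcM normc_conjc.
move=> + eqz; rewrite -eqz expr2 ler_pM2l// => h.
by rewrite -(fineK fin) lee_fin.
Qed.

End complex_integral.

(** * Limits of extended real and complex sequences *)

Section complex_limits.
Context (R : realType).

Lemma squeeze0_EFin (a : nat -> R) (e : nat -> \bar R) : (forall n, 0 <= a n) ->
  (forall n, ((a n)%:E <= e n)%E) -> e @ \oo --> 0%E -> a @ \oo --> (0 : R).
Proof.
move=> a0 ae e0.
have : (EFin \o a) @ \oo --> (0%:E : \bar R).
  by apply: (squeeze_cvge _ (cvg_cst 0%E) e0); apply: nearW => n; rewrite lee_fin a0/= ae.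
by move/fine_cvg.
Qed.

Lemma cvge0P (e : nat -> \bar R) : (forall n, (0 <= e n)%E) ->
  e @ \oo --> 0%E <->
  (forall eps : R, 0 < eps -> exists N, forall n, (N <= n)%N -> (e n <= eps%:E)%E).
Proof.
move=> e0; split => [/fine_cvgP[efin /cvgr0Pnorm_le efine] eps eps0|eN].
  have [N _ NP] : \forall n \near \oo, (e n <= eps%:E)%E.
    near=> n; rewrite -(fineK (x := e n)); last by near: n.
    rewrite lee_fin (le_trans (ler_norm _))//; near: n; exact: efine.
  by exists N => n Nn; exact: NP.
apply/fine_cvgP; split.
  have [N NP] := eN 1 ltr01; exists N => // n /= Nn.
  by rewrite ge0_fin_numE// (le_lt_trans (NP _ Nn))// ltry.
apply/cvgr0Pnorm_le => eps eps0; have [N NP] := eN _ eps0; exists N => // n /= Nn.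
rewrite ger0_norm ?fine_ge0// -lee_fin fineK ?NP// ge0_fin_numE//.
by rewrite (le_lt_trans (NP _ Nn))// ltry.
Unshelve. all: by end_near. Qed.

(** Phrased through the real sequence of moduli, so that the squeeze and product rules for real
    limits apply directly. *)
Definition ccvg (z : nat -> R[i]) (l : R[i]) : Prop :=
  (fun n => normc (z n - l)) @ \oo --> (0 : R).

Lemma ccvg_normcB (z : nat -> R[i]) (l c : R[i]) : ccvg z l ->
  (fun n => normc (z n - c)) @ \oo --> normc (l - c).
Proof.
move=> zl; apply/subr_cvg0; apply: norm_cvg0.
apply: (squeeze_cvgr _ (cvg_cst 0) zl).
apply: nearW => n; rewrite normr_ge0 (le_trans (ler_dist_normc _ _))// opprB addrA.
by rewrite subrK.
Qed.

End complex_limits.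

(** * The complex L^2 space: Minkowski, Cauchy-Schwarz, Fatou *)

Section complex_Lp.
Context (d : measure_display) (T : measurableType d) (R : realType).
Variable mu : {measure set T -> \bar R}.
Implicit Types (f g : T -> R[i]).
Local Notation L1 f := (cLp mu 1%:E f).
Local Notation L2 f := (cLp mu 2%:E f).
Local Notation N2 f := (cLnorm mu 2%:E f).

Lemma cLp1P f : L1 f <-> cintegrable mu setT f.
Proof.
rewrite cintegrableP// /cLp /cLnorm Lnorm1.
by under eq_integral do rewrite /= ger0_norm ?normc_ge0//.
Qed.

Lemma cLnorm2E f : N2 f = ((\int[mu]_x (normc (f x) ^+ 2)%:E) `^ 2^-1)%E.
Proof.
rewrite /cLnorm unlock; congr (_ `^ _)%E; apply: eq_integral => x _.
by rewrite /= ger0_norm ?normc_ge0// powR_mulrn ?normc_ge0.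
Qed.

Lemma cLnorm_ge0 p f : (0 <= cLnorm mu p f)%E.
Proof. exact: Lnorm_ge0. Qed.

(** A product of extended reals, so that an infinite norm is covered as well: both sides are then
    [+oo]. *)
Lemma sqr_cLnorm2 f : (N2 f * N2 f = \int[mu]_x (normc (f x) ^+ 2)%:E)%E.
Proof.
rewrite cLnorm2E; set e := (\int[mu]_x _)%E.
have e0 : (0 <= e)%E by apply: integral_ge0 => x _; rewrite lee_fin sqr_ge0.
case: e e0 => [r r0|_|//]; last by rewrite poweRyr ?invr_eq0// mulyy.
by rewrite poweR_EFin -EFinM powR12_sqrt// -expr2 sqr_sqrtr.
Qed.

Lemma cLp2P f : L2 f <-> cmeasurable setT f /\ (\int[mu]_x (normc (f x) ^+ 2)%:E < +oo)%E.
Proof.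
rewrite /cLp -sqr_cLnorm2; split => -[mf fy]; split=> //.
  by rewrite lte_mul_pinfty// ?cLnorm_ge0// ge0_fin_numE ?cLnorm_ge0.
by rewrite ltNge leye_eq; apply/eqP => ne; move: fy; rewrite ne mulyy.
Qed.

Lemma cLp_measurable p f : cLp mu p f -> cmeasurable setT f.
Proof. by case. Qed.

Lemma le_cLnorm2 f g : cmeasurable setT f -> cmeasurable setT g ->
  (forall x, normc (f x) <= normc (g x)) -> (N2 f <= N2 g)%E.
Proof.
move=> mf mg fg; rewrite !cLnorm2E gt0_ler_poweR ?invr_ge0//.
- by rewrite in_itv/= leey andbT integral_ge0// => x _; rewrite lee_fin sqr_ge0.
- by rewrite in_itv/= leey andbT integral_ge0// => x _; rewrite lee_fin sqr_ge0.
apply: ge0_le_integral => //; try exact: measurable_normc_sqrE.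
- by move=> x _; rewrite lee_fin sqr_ge0.
- by move=> x _; rewrite lee_fin ler_sqr ?nnegrE ?normc_ge0.
Qed.

Lemma eq_cLnorm p f g : (forall x, normc (f x) = normc (g x)) -> cLnorm mu p f = cLnorm mu p g.
Proof. by move=> fg; apply: eq_Lnorm => x; rewrite fg. Qed.

Lemma cLnormD2 f g : cmeasurable setT f -> cmeasurable setT g ->
  (N2 (fun x => (f x + g x)%R) <= N2 f + N2 g)%E.
Proof.
move=> mf mg; have mf' := measurable_normc mf; have mg' := measurable_normc mg.
have := @minkowski_EFin _ _ _ mu _ _ 2 mf' mg'; rewrite ler1n => /(_ isT).
apply: le_trans.
have -> : EFin \o ((fun x => normc (f x)) \+ (fun x => normc (g x)))%R =
    (fun x => (normc (normc (f x) + normc (g x))%:C)%:E).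
  by apply/funext => x; rewrite normc_real ger0_norm ?addr_ge0 ?normc_ge0.
apply: le_cLnorm2; first exact: cmeasurableD.
  by apply: cmeasurable_realC; exact: measurable_funD.
move=> x; rewrite normc_real ger0_norm ?addr_ge0 ?normc_ge0//.
exact: le_normcD.
Qed.

Lemma cLnormN p f : cLnorm mu p (fun x => - f x) = cLnorm mu p f.
Proof. by apply: eq_cLnorm => x; rewrite normcN. Qed.

Lemma cLnorm_distC p f g :
  cLnorm mu p (fun x => f x - g x) = cLnorm mu p (fun x => g x - f x).
Proof. by apply: eq_cLnorm => x; rewrite -normcN opprB. Qed.

Lemma cLp2D f g : L2 f -> L2 g -> L2 (fun x => f x + g x).
Proof.
move=> [mf fy] [mg gy]; split; first exact: cmeasurableD.
by rewrite (le_lt_trans (cLnormD2 mf mg))// lte_add_pinfty.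
Qed.

Lemma cLp2N f : L2 f -> L2 (fun x => - f x).
Proof. by move=> [mf fy]; split; [exact: cmeasurableN|rewrite cLnormN]. Qed.

Lemma cLp2J f : L2 f -> L2 (fun x => conjc (f x)).
Proof.
move=> [mf fy]; split; first exact: cmeasurableJ.
by rewrite (_ : cLnorm _ _ _ = N2 f)//; apply: eq_cLnorm => x; rewrite normc_conjc.
Qed.

Lemma cLp2B f g : L2 f -> L2 g -> L2 (fun x => f x - g x).
Proof. by move=> lf lg; apply: cLp2D => //; exact: cLp2N. Qed.

Lemma cLp2_le f g (M : R) : L2 g -> cmeasurable setT f ->
  (forall x, normc (f x) <= M * normc (g x)) -> L2 f.
Proof.
move=> /cLp2P[mg gy] mf fg; apply/cLp2P; split => //.
have M0 x : 0 <= M * normc (g x) by exact: le_trans (normc_ge0 _) (fg x).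
apply: (@le_lt_trans _ _ (\int[mu]_x ((M ^+ 2)%:E * (normc (g x) ^+ 2)%:E))%E).
  apply: ge0_le_integral => //.
  - by move=> x _; rewrite lee_fin sqr_ge0.
  - exact: measurable_normc_sqrE.
  - by apply/measurable_funeM/measurable_normc_sqrE.
  - by move=> x _; rewrite -EFinM lee_fin -exprMn ler_sqr ?nnegrE ?normc_ge0.
rewrite ge0_integralZl//; first by rewrite lte_mul_pinfty// lee_fin sqr_ge0.
- exact: measurable_normc_sqrE.
- by move=> x _; rewrite lee_fin sqr_ge0.
- by rewrite lee_fin sqr_ge0.
Qed.

Lemma cauchy_schwarz_normc f g : cmeasurable setT f -> cmeasurable setT g ->
  (\int[mu]_x (normc (f x * g x))%:E <= N2 f * N2 g)%E.
Proof.
move=> mf mg; have mf' := measurable_normc mf; have mg' := measurable_normc mg.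
have := @hoelder _ _ _ mu _ _ 2 2 mf' mg'.
rewrite !ltr0n Lnorm1 => /(_ isT isT) h.
apply: le_trans (h _); last by lra.
rewrite le_eqVlt; apply/orP; left; apply/eqP; apply: eq_integral => x _.
by rewrite /= ComplexField.Normc.normcM ger0_norm ?mulr_ge0 ?normc_ge0.
Qed.

Lemma cintegrable_mul f g : L2 f -> L2 g -> cintegrable mu setT (fun x => f x * g x).
Proof.
move=> [mf fy] [mg gy]; apply/cintegrableP => //; split; first exact: cmeasurableM.
rewrite (le_lt_trans (cauchy_schwarz_normc mf mg))//.
by rewrite lte_mul_pinfty// ?cLnorm_ge0// ge0_fin_numE ?cLnorm_ge0.
Qed.

Lemma cauchy_schwarz f g : L2 f -> L2 g ->
  ((normc (cintegral mu setT (fun x => (f x * g x)%R)))%:E <= N2 f * N2 g)%E.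
Proof.
move=> lf lg; apply: le_trans (normc_cintegral_le _ (cintegrable_mul lf lg)) _ => //.
exact: cauchy_schwarz_normc lf.1 lg.1.
Qed.

Lemma cLnorm2_triangle f g h : L2 f -> L2 g -> L2 h ->
  (N2 (fun x => (f x - h x)%R) <= N2 (fun x => (f x - g x)%R) + N2 (fun x => (g x - h x)%R))%E.
Proof.
move=> lf lg lh; apply: le_trans (cLnormD2 (cLp2B lf lg).1 (cLp2B lg lh).1).
by rewrite le_eqVlt; apply/orP; left; apply/eqP/eq_cLnorm => t; rewrite addrA subrK.
Qed.

Lemma cLnorm2_fin_num f : L2 f -> N2 f \is a fin_num.
Proof. by move=> [_ ?]; rewrite ge0_fin_numE ?cLnorm_ge0. Qed.

(** Two triangle inequalities squeeze the norms; finiteness of [N2 f] keeps the subtraction in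
    [\bar R] well defined. *)
Lemma cLp_cvg_cLnorm2 (u : nat -> T -> R[i]) f : (forall n, L2 (u n)) -> L2 f ->
  cLp_cvg mu 2%:E u f -> (fun n => N2 (u n)) @ \oo --> N2 f.
Proof.
move=> lu lf uf.
have lB n : L2 (fun x => u n x - f x) by exact: cLp2B.
apply: (@squeeze_cvge _ _ _ _ (fun n => N2 f - N2 (fun x => u n x - f x)%R)%E _
    (fun n => N2 f + N2 (fun x => u n x - f x)%R)%E).
- apply: nearW => n; apply/andP; split.
    rewrite leeBlDr ?cLnorm2_fin_num// cLnorm_distC.
    apply: le_trans (cLnormD2 (lu n).1 (cLp2B lf (lu n)).1).
    by rewrite le_eqVlt; apply/orP; left; apply/eqP/eq_cLnorm => x; rewrite addrC subrK.
  apply: le_trans (cLnormD2 lf.1 (lB n).1).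
  by rewrite le_eqVlt; apply/orP; left; apply/eqP/eq_cLnorm => x; rewrite addrC subrK.
- rewrite -[X in _ --> X]sube0; apply: cvgeB => //; last exact: cvg_cst.
  by rewrite fin_num_adde_defl// cLnorm2_fin_num.
- rewrite -[X in _ --> X]adde0; apply: cvgeD => //; last exact: cvg_cst.
  by rewrite fin_num_adde_defl.
Qed.

(** By Cauchy-Schwarz. Applied at each point to convolutions and to wavelet coefficients, it is the
    source of all pointwise limits below. *)
Lemma cLp_cvg_cintegral (u : nat -> T -> R[i]) f g : (forall n, L2 (u n)) -> L2 f -> L2 g ->
  cLp_cvg mu 2%:E u f ->
  ccvg (fun n => cintegral mu setT (fun x => u n x * g x))
    (cintegral mu setT (fun x => f x * g x)).
Proof.
move=> lu lf lg uf; rewrite /ccvg.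
have uf0 : (fun n => N2 (fun x => u n x - f x)%R * N2 g)%E @ \oo --> (0 : \bar R).
  rewrite -(mul0e (N2 g)); apply: cvgeM => //; last exact: cvg_cst.
  by rewrite mule_def_fin// cLnorm2_fin_num.
apply: (squeeze0_EFin (fun n => normc_ge0 _) _ uf0) => n.
rewrite -cintegralB//; try exact: cintegrable_mul.
under eq_cintegral do rewrite -mulrBl.
by apply: cauchy_schwarz => //; exact: cLp2B.
Qed.

Lemma cLnorm2_leP f (k : R) : 0 <= k ->
  (N2 f <= k%:E)%E = (\int[mu]_x (normc (f x) ^+ 2)%:E <= (k ^+ 2)%:E)%E.
Proof.
move=> k0; rewrite -sqr_cLnorm2 expr2 EFinM.
have := cLnorm_ge0 2 f; case: (N2 f) => [r||//].
  by rewrite !lee_fin => r0; rewrite -!expr2 ler_sqr.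
by move=> _; rewrite mulyy !leye_eq.
Qed.

(** Fatou for the squared moduli, whose lower limit is a genuine limit at every point. The bound
    thus reaches [xl] before [xl] is known to be in L^2. *)
Lemma cLnorm2_fatou (x : nat -> T -> R[i]) (xl : T -> R[i]) (k : R) :
  (forall n, cmeasurable setT (x n)) ->
  (forall t, ccvg (x ^~ t) (xl t)) -> 0 <= k ->
  (forall n, (N2 (x n) <= k%:E)%E) -> (N2 xl <= k%:E)%E.
Proof.
move=> mx xxl k0 xk; rewrite cLnorm2_leP//.
have /= := @fatou _ _ _ mu setT measurableT (fun n t => (normc (x n t) ^+ 2)%:E)
  (fun n => measurable_normc_sqrE (mx n)).
have -> : (fun t => limn_einf (fun n => (normc (x n t) ^+ 2)%:E)) =
    (fun t => (normc (xl t) ^+ 2)%:E).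
  apply/funext => t; have h : (fun n => (normc (x n t) ^+ 2)%:E) @ \oo --> (normc (xl t) ^+ 2)%:E.
    apply: cvg_EFin; first exact: nearW.
    rewrite /comp /= -(subr0 (xl t)).
    under eq_fun do rewrite -(subr0 (x _ t)).
    by apply: cvgM; exact: ccvg_normcB.
  exact: (cvg_limn_einf_sup h).1.
move=> h; apply: le_trans (h _) _; first by move=> n t _; rewrite lee_fin sqr_ge0.
rewrite limn_einf_lim; apply: lime_le; first exact: is_cvg_einfs.
apply: nearW => n; apply: le_trans (_ : _ <= (\int[mu]_x0 (normc (x n x0) ^+ 2)%:E))%E _.
  by apply: ereal_inf_lbound; exists n => /=.
by rewrite -cLnorm2_leP.
Qed.

End complex_Lp.

(* By Fatou's lemma, the distance from [x n] to its pointwise limit is bounded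
   by the Cauchy modulus of [x], which is that of [y]. *)
Lemma cLnorm2_pointwise_isometry (d d' : measure_display) (T : measurableType d)
    (T' : measurableType d') (R : realType)
    (mu : {measure set T -> \bar R}) (nu : {measure set T' -> \bar R})
    (x : nat -> T' -> R[i]) (xl : T' -> R[i])
    (y : nat -> T -> R[i]) (yl : T -> R[i]) (c : R) :
  (forall n, cmeasurable setT (x n)) -> cmeasurable setT xl ->
  (forall t, ccvg (x ^~ t) (xl t)) ->
  (forall n, cLp mu 2%:E (y n)) -> cLp mu 2%:E yl -> cLp_cvg mu 2%:E y yl -> 0 <= c ->
  (forall n, cLnorm nu 2%:E (x n) = c%:E * cLnorm mu 2%:E (y n))%E ->
  (forall n m, cLnorm nu 2%:E (fun t => x n t - x m t)%R =
     c%:E * cLnorm mu 2%:E (fun t => y n t - y m t)%R)%E ->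
  (cLnorm nu 2%:E xl = c%:E * cLnorm mu 2%:E yl)%E.
Proof.
move=> mx mxl xxl ly lyl yyl c0 xy xyB.
have lxn n : cLp nu 2%:E (x n).
  by split => //; rewrite xy lte_mul_pinfty//; case: (ly n).
have dist n (k : R) : 0 <= k ->
    (forall m, (n <= m)%N -> (cLnorm nu 2%:E (fun t => x m t - x n t)%R <= k%:E)%E) ->
    (cLnorm nu 2%:E (fun t => xl t - x n t)%R <= k%:E)%E.
  (* Only indices beyond [n] are controlled, hence the reindexing by [m + n] before taking the limit
     in [m]. *)
  move=> k0 xk; apply: (cLnorm2_fatou (x := fun m t => x (m + n)%N t - x n t)) => //.
  - by move=> m; exact: cmeasurableB.
  - move=> t; rewrite /ccvg; under eq_fun do rewrite opprB addrA subrK.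
    by have := xxl t; rewrite /ccvg -(cvg_shiftn n).
  - by move=> m; apply: xk; rewrite leq_addl.
have ltyn n : cLnorm mu 2%:E (fun t => y n t - yl t)%R \is a fin_num.
  by apply: cLnorm2_fin_num; exact: cLp2B.
have xcvg : cLp_cvg nu 2%:E x xl.
  apply/cvge0P => [n|eps eps0]; first exact: cLnorm_ge0.
  (* The distance from [y m] to [y n] is bounded through [yl], at twice the tolerance, and then
     multiplied by [c]; the added 1 keeps the denominator positive when [c] is 0. *)
  have eps'0 : 0 < eps / (c *+ 2 + 1) by rewrite divr_gt0// ltr_wpDl// mulrn_wge0.
  move/cvge0P : yyl => /(_ (fun=> cLnorm_ge0 _ _ _)) /(_ _ eps'0)[N NP].
  exists N => n Nn; rewrite cLnorm_distC; apply: dist => [|m nm]; first exact: ltW.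
  rewrite xyB; apply: (@le_trans _ _ (c%:E * (eps / (c *+ 2 + 1) + eps / (c *+ 2 + 1))%:E)%E).
    apply: lee_pmul => //; first exact: cLnorm_ge0.
    apply: le_trans (cLnorm2_triangle (ly m) lyl (ly n)) _.
    rewrite [X in (_ + X <= _)%E]cLnorm_distC [leRHS]EFinD; apply: leeD; apply: NP => //.
    exact: leq_trans Nn nm.
  have k0 : 0 < c *+ 2 + 1 by rewrite ltr_wpDl// mulrn_wge0.
  rewrite -EFinM lee_fin (_ : c * _ = eps / (c *+ 2 + 1) * (c *+ 2)); last by ring.
  by rewrite -[leRHS](divfK (lt0r_neq0 k0)) ler_pM2l// lerDl.
have lxl : cLp nu 2%:E xl.
  (* A single term at distance at most 1 places [xl] in L^2. *)
  split => //; move/cvge0P : xcvg => /(_ (fun=> cLnorm_ge0 _ _ _)) /(_ 1 ltr01)[n /(_ n (leqnn n))].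
  rewrite cLnorm_distC => xn.
  have : (cLnorm nu 2%:E xl <= cLnorm nu 2%:E (fun t => xl t - x n t)%R + cLnorm nu 2%:E (x n))%E.
    apply: le_trans (@cLnormD2 _ _ _ nu _ _ (cmeasurableB mxl (mx n)) (mx n)).
    by rewrite le_eqVlt; apply/orP; left; apply/eqP/eq_cLnorm => t; rewrite subrK.
  move/le_lt_trans; apply; apply: lte_add_pinfty; last by case: (lxn n).
  by rewrite (le_lt_trans xn)// ltry.
have h1 := cLp_cvg_cLnorm2 lxn lxl xcvg.
have h2 := cLp_cvg_cLnorm2 ly lyl yyl.
have e : (fun n => cLnorm nu 2%:E (x n)) = (fun n => c%:E * cLnorm mu 2%:E (y n))%E.
  by apply/funext => n; rewrite xy.
by rewrite -(cvg_lim _ h1)// e; apply/cvg_lim => //; exact: cvgeZl.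
Qed.

(** * Affine change of variable for Lebesgue measure *)

Section affine_change_of_variable.
Context (R : realType).
Local Notation mu := (@lebesgue_measure R).
Variables (a b : R).
Hypothesis a0 : a != 0.

Let phi (x : measurableTypeR R) : measurableTypeR R := a * x + b.

Lemma measurable_affine : measurable_fun setT phi.
Proof. by apply: measurable_funD => //; exact: measurable_funM. Qed.

Let nu : {measure set (measurableTypeR R) -> \bar R} :=
  measure_function_pushforward__canonical__measure_function_Measure mu measurable_affine.

Let anu : {measure set (measurableTypeR R) -> \bar R} :=
  mscale (NngNum (normr_ge0 a)) nu.

(** Lebesgue measure is determined by its values on half-open intervals, so it suffices to compare
    lengths there with [anu], the pushforward by [phi] rescaled by [|a|]. *)
Lemma lebesgue_measure_affine (A : set (measurableTypeR R)) : measurable A ->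
  (mu A = `|a|%:E * mu (phi @^-1` A))%E.
Proof.
move=> mA.
rewrite (@lebesgue_measure_unique R anu)//= => _ [[x y] _ <-] /=.
rewrite /anu /mscale /= /pushforward.
have [a_gt0|a_lt0|/eqP] := ltgtP 0 a; last by rewrite eq_sym (negbTE a0).
- rewrite (_ : phi @^-1` _ = `](x - b) / a, (y - b) / a]%classic); last first.
    apply/seteqP; split => z; rewrite /phi /= !in_itv/= => /andP[].
      by rewrite ltr_pdivrMr// ler_pdivlMr// ltrBlDr lerBrDr mulrC => -> ->.
    by rewrite ltr_pdivrMr// ler_pdivlMr// ltrBlDr lerBrDr mulrC => -> ->.
  rewrite !lebesgue_measure_itv/= !lte_fin ltr_pM2r ?invr_gt0// ltrD2r.
  case: ifP => _; last by rewrite mule0.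
  rewrite -!EFinB -EFinM gtr0_norm//; congr (_%:E).
  by field.
(* A negative slope swaps the endpoints and moves the closed end to the left; the length is
   unaffected. *)
- rewrite (_ : phi @^-1` _ = `[(y - b) / a, (x - b) / a[%classic); last first.
    apply/seteqP; split => z; rewrite /phi /= !in_itv/= => /andP[].
      by rewrite ltr_ndivlMr// ler_ndivrMr// ltrBlDr lerBrDr mulrC => -> ->.
    by rewrite ltr_ndivlMr// ler_ndivrMr// ltrBlDr lerBrDr mulrC => -> ->.
  rewrite !lebesgue_measure_itv/= !lte_fin ltr_nM2r ?invr_lt0// ltrD2r.
  case: ifP => _; last by rewrite mule0.
  rewrite -!EFinB -EFinM ltr0_norm//; congr (_%:E).
  by field.
Qed.

Lemma ge0_integral_affine (f : R -> \bar R) : measurable_fun setT f ->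
  (forall x, (0 <= f x)%E) ->
  (\int[mu]_x f (a * x + b)%R = `|a|^-1%:E * \int[mu]_x f x)%E.
Proof.
move=> mf f0.
have -> : (\int[mu]_x f x)%E = (`|a|%:E * \int[mu]_x f (a * x + b)%R)%E.
  transitivity (\int[anu]_x f x)%E.
    by apply: eq_measure_integral => A mA _; exact: lebesgue_measure_affine.
  rewrite ge0_integral_mscale//= ge0_integral_pushforward//.
  exact: measurable_affine.
by rewrite muleA -EFinM mulVf ?normr_eq0// mul1e.
Qed.

Lemma integral_affine (f : R -> \bar R) : mu.-integrable setT f ->
  mu.-integrable setT (fun x => f (a * x + b)%R) /\
  (\int[mu]_x f (a * x + b)%R = `|a|^-1%:E * \int[mu]_x f x)%E.
Proof.
move=> if_; have mf := measurable_int _ if_.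
have mfphi : measurable_fun setT (fun x => f (a * x + b)).
  exact: (measurableT_comp mf measurable_affine).
split.
  apply/integrableP; split => //.
  rewrite (ge0_integral_affine (f := fun x => `|f x|%E))//; last exact: measurableT_comp.
  by case/integrableP : if_ => _ ?; rewrite lte_mul_pinfty// lee_fin invr_ge0.
rewrite integralE [in RHS]integralE muleBr//; last first.
  rewrite fin_num_adde_defl// fin_numN.
  exact: integrable_neg_fin_num.
congr (_ - _)%E.
- rewrite -(ge0_integral_affine (f := f^\+%E))//; last exact: measurable_funepos.
  by apply: eq_integral => x _; rewrite -/((f \o phi)^\+%E x) funepos_comp.
- rewrite -(ge0_integral_affine (f := f^\-%E))//; last exact: measurable_funeneg.
  by apply: eq_integral => x _; rewrite -/((f \o phi)^\-%E x) funeneg_comp.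
Qed.

Lemma cintegrable_affine (f : R -> R[i]) : cintegrable mu setT f ->
  cintegrable mu setT (fun x => f (a * x + b)).
Proof. by move=> [/integral_affine[f1 _] /integral_affine[f2 _]]. Qed.

Lemma cintegral_affine (f : R -> R[i]) : cintegrable mu setT f ->
  cintegral mu setT (fun x => f (a * x + b)) = `|a|^-1%:C * cintegral mu setT f.
Proof.
move=> [f1 f2]; have [_ e1] := integral_affine f1; have [_ e2] := integral_affine f2.
rewrite /cintegral /Rintegral e1 e2 !fineM ?integrable_fin_num//.
by apply: complexP; rewrite !ReImE/=; ring.
Qed.

Lemma cmeasurable_affine (f : R -> R[i]) : cmeasurable setT f ->
  cmeasurable setT (fun x => f (a * x + b)).
Proof. move=> mf; exact: (cmeasurableT_comp mf measurable_affine). Qed.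

Lemma cLnorm2_affine (f : R -> R[i]) : cmeasurable setT f ->
  (cLnorm mu 2%:E (fun x => f (a * x + b)%R) =
   (Num.sqrt `|a|)^-1%:E * cLnorm mu 2%:E f)%E.
Proof.
move=> mf; rewrite !cLnorm2E.
rewrite (ge0_integral_affine (f := fun x => (normc (f x) ^+ 2)%:E)).
- rewrite poweRM ?lee_fin ?invr_ge0//; last by apply: integral_ge0 => x _; rewrite lee_fin sqr_ge0.
  by rewrite poweR_EFin powR12_sqrt ?invr_ge0// sqrtrV.
- exact: measurable_normc_sqrE.
- by move=> x; rewrite lee_fin sqr_ge0.
Qed.

Lemma cLp2_affine (f : R -> R[i]) : cLp mu 2%:E f -> cLp mu 2%:E (fun x => f (a * x + b)).
Proof.
move=> [mf fy]; split; first exact: cmeasurable_affine.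
by rewrite cLnorm2_affine// lte_mul_pinfty// lee_fin invr_ge0 sqrtr_ge0.
Qed.

End affine_change_of_variable.

(** * Fubini's theorem for complex integrands *)

Section complex_fubini.
Context (d1 d2 : measure_display) (T1 : measurableType d1) (T2 : measurableType d2)
  (R : realType).
Variables (m1 : {sigma_finite_measure set T1 -> \bar R})
  (m2 : {sigma_finite_measure set T2 -> \bar R}).
Implicit Types (K : T1 * T2 -> R[i]) (k : T1 * T2 -> R).

Lemma integrable_Rintegral12 k : (m1 \x m2)%E.-integrable setT (EFin \o k) ->
  m1.-integrable setT (fun x => (Rintegral m2 setT (fun y => k (x, y)))%:E) /\
  Rintegral m1 setT (fun x => Rintegral m2 setT (fun y => k (x, y))) =
  Rintegral (m1 \x m2)%E setT k.
Proof.
move=> ik; have iF := integrable_fubini_F ik; have aeF := integrable_ae measurableT iF.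
have mfF : measurable_fun setT (fun x => (fine (fubini_F m2 (EFin \o k) x))%:E).
  by apply/measurable_EFinP; apply: measurableT_comp => //; exact: measurable_int iF.
have aeE : ae_eq m1 setT (fubini_F m2 (EFin \o k)) (fun x => (fine (fubini_F m2 (EFin \o k) x))%:E).
  by apply: filterS aeF => x /= /[apply] fF; rewrite fineK.
have ifF : m1.-integrable setT (fun x => (fine (fubini_F m2 (EFin \o k) x))%:E).
  apply/integrableP; split => //.
  case/integrableP : (iF) => mF; congr (_ < _)%E.
  apply: ge0_ae_eq_integral => //; try exact: measurableT_comp.
  by apply: filterS aeE => x /= /[apply] ->.
split => //; rewrite /Rintegral; congr fine.
rewrite -[RHS]integral12_prod_meas1//; apply/esym.
by apply: ae_eq_integral => //; exact: measurable_int iF.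
Qed.

Lemma integrable_Rintegral21 k : (m1 \x m2)%E.-integrable setT (EFin \o k) ->
  m2.-integrable setT (fun y => (Rintegral m1 setT (fun x => k (x, y)))%:E) /\
  Rintegral m2 setT (fun y => Rintegral m1 setT (fun x => k (x, y))) =
  Rintegral (m1 \x m2)%E setT k.
Proof.
move=> ik; have mk := measurable_int _ ik.
(* The absolute value of the inner integral is at most the integral of [|k|], whose outer integral
   is finite by Tonelli. *)
have iF : m2.-integrable setT (fubini_G m1 (EFin \o k)).
  apply/integrableP; split; first exact: (measurable_fubini_G ik).
  have mka : measurable_fun setT (fun xy => `|(k xy)%:E|)%E by exact: measurableT_comp.
  apply: le_lt_trans ((integrable21ltyP m1 m2 mk).1 ik); apply: ge0_le_integral => //.
  - by apply: measurableT_comp => //; exact: (measurable_fubini_G ik).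
  - exact: (measurable_fun_fubini_tonelli_G _ mka).
  - move=> y _; apply: le_abse_integral => //.
    exact: (measurableT_comp mk (measurable_fun_pair _ _)).
have aeF := integrable_ae measurableT iF.
have mfF : measurable_fun setT (fun x => (fine (fubini_G m1 (EFin \o k) x))%:E).
  by apply/measurable_EFinP; apply: measurableT_comp => //; exact: measurable_int iF.
have aeE : ae_eq m2 setT (fubini_G m1 (EFin \o k)) (fun x => (fine (fubini_G m1 (EFin \o k) x))%:E).
  by apply: filterS aeF => x /= /[apply] fF; rewrite fineK.
have ifF : m2.-integrable setT (fun x => (fine (fubini_G m1 (EFin \o k) x))%:E).
  apply/integrableP; split => //.
  case/integrableP : (iF) => mF; congr (_ < _)%E.
  apply: ge0_ae_eq_integral => //; try exact: measurableT_comp.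
  by apply: filterS aeE => x /= /[apply] ->.
split => //; rewrite /Rintegral; congr fine.
rewrite -[RHS]integral21_prod_meas1//; apply/esym.
by apply: ae_eq_integral => //; exact: measurable_int iF.
Qed.

Lemma cfubini K : cintegrable (m1 \x m2)%E setT K ->
  cintegral m1 setT (fun x => cintegral m2 setT (fun y => K (x, y))) =
  cintegral m2 setT (fun y => cintegral m1 setT (fun x => K (x, y))).
Proof.
move=> [k1 k2].
have [_ e1] := integrable_Rintegral12 k1; have [_ e1'] := integrable_Rintegral21 k1.
have [_ e2] := integrable_Rintegral12 k2; have [_ e2'] := integrable_Rintegral21 k2.
by congr (_ +i* _); rewrite ?e1 ?e1' ?e2 ?e2'.
Qed.

Lemma cintegrable_prod K : cmeasurable setT K ->
  (\int[m1]_x \int[m2]_y (normc (K (x, y)))%:E < +oo)%E ->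
  cintegrable (m1 \x m2)%E setT K.
Proof.
move=> mK Ky; apply/cintegrableP => //; split => //.
rewrite fubini_tonelli1//; first exact: measurable_normcE.
by move=> x; rewrite lee_fin normc_ge0.
Qed.

End complex_fubini.

(** * The Poisson kernel as the Fourier integral of a two-sided exponential *)

Section poisson_kernel.
Context (R : realType).
Local Notation mu := (@lebesgue_measure R).
Variables (e u : R).
Hypothesis e0 : 0 < e.

Let D := e ^+ 2 + u ^+ 2.
Let D0 : D != 0. Proof. by rewrite gt_eqF// ltr_pwDl ?exprn_gt0 ?sqr_ge0. Qed.

(** Chosen so that [F] is a primitive of [exp (- e w) (1 + cos (u w))]: the first two terms are the
    real part of [exp (i u w) / (- e + i u)], the last one accounts for the constant 1. That 1 makes
    the integrand nonnegative, as the fundamental theorem on a half line requires, and is subtracted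
    again in [cintegral_poisson]. *)
Let g (w : R) := (u / D) * sin (u * w) - (e / D) * cos (u * w) - e^-1.
Let F (w : R) := expR (- e * w) * g w.

Let is_derive_lin (k x : R) : is_derive x 1 (fun w : R => k * w) k.
Proof. by rewrite -[X in is_derive _ _ _ X]mulr1; exact: is_deriveZ. Qed.

Let is_derive_F (x : R) : is_derive x 1 F (expR (- e * x) * (1 + cos (u * x))).
Proof.
have dE : is_derive x 1 (fun w : R => expR (- e * w)) (expR (- e * x) * - e).
  exact: (is_derive1_comp _ (is_derive_lin (- e) x)).
have dS : is_derive x 1 (fun w : R => sin (u * w)) (cos (u * x) * u).
  exact: (is_derive1_comp _ (is_derive_lin u x)).
have dC : is_derive x 1 (fun w : R => cos (u * w)) (- sin (u * x) * u).
  exact: (is_derive1_comp _ (is_derive_lin u x)).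
have dg := is_deriveB (is_deriveB (is_deriveZ (u / D) dS) (is_deriveZ (e / D) dC))
  (is_derive_cst e^-1 x 1).
have dF := is_deriveM dE dg.
apply: (is_derive_eq dF); rewrite /GRing.scale /=.
rewrite [X in _ + X * _](_ : _ = g x)// /g.
have := D0; rewrite /D => ?; field.
by rewrite lt0r_neq0//=.
Qed.

Let continuous_expNM : continuous (fun w : R => expR (- e * w)).
Proof.
move=> x; apply: (@continuous_comp _ _ _ (fun w => - e * w) expR); last exact: continuous_expR.
exact: mulrl_continuous.
Qed.

Let g_bound w : `|g w| <= `|u / D| + `|e / D| + e^-1.
Proof.
rewrite /g; apply: le_trans (ler_normB _ _) _; apply: lerD; last first.
  by rewrite ger0_norm// invr_ge0 ltW.
apply: le_trans (ler_normB _ _) _; rewrite !normrM; apply: lerD.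
  by rewrite ler_piMr// ler_norml sin_geN1 sin_le1.
by rewrite ler_piMr// ler_norml cos_geN1 cos_le1.
Qed.

Let cvg_expNM : (fun w => expR (- e * w)) @ +oo%R --> (0 : R).
Proof.
rewrite (_ : (fun w => expR (- e * w)) = (fun z => expR (- z)) \o (fun z => e * z)); last first.
  by apply/funext => x /=; rewrite mulNr.
apply: (@cvg_comp _ _ _ _ _ _ (pinfty_nbhs R)); last exact: cvgr_expR.
exact: gt0_cvgMry.
Qed.

Let cvg_F : F @ +oo%R --> (0 : R).
Proof.
apply: norm_cvg0.
apply: (squeeze_cvgr (f := cst 0) (h := fun w => expR (- e * w) * (`|u / D| + `|e / D| + e^-1))).
- apply: nearW => w; rewrite normr_ge0/= normrM ger0_norm ?expR_ge0//.
  by rewrite ler_wpM2l ?expR_ge0.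
- exact: cvg_cst.
- by rewrite -[X in _ --> X](mul0r (`|u / D| + `|e / D| + e^-1)); apply: cvgM => //; exact: cvg_cst.
Qed.

(** With [|w|] also inside the cosine, [h] is the half-line integrand composed with the norm, so
    that evenness and continuity are immediate. *)
Let h (w : R) := expR (- e * `|w|) * (1 + cos (u * `|w|)).

Let continuous_h0 : continuous (fun w : R => expR (- e * w) * (1 + cos (u * w))).
Proof.
move=> x; apply: cvgM; first exact: continuous_expNM.
apply: cvgD; first exact: cvg_cst.
apply: (@continuous_comp _ _ _ (fun w => u * w) cos); last exact: continuous_cos.
exact: mulrl_continuous.
Qed.

Let continuous_h : continuous h.
Proof.
move=> x; apply: (@continuous_comp _ _ _ (@Num.norm R R) (fun w : R => expR (- e * w) * (1 + cos (u * w)))).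
  exact: norm_continuous.
exact: continuous_h0.
Qed.

Let h_ge0 w : 0 <= h w.
Proof. by rewrite mulr_ge0 ?expR_ge0// -lerBlDl sub0r cos_geN1. Qed.

Let integral_h : (\int[mu]_x (h x)%:E = (2 * (e / D + e^-1))%:E)%E.
Proof.
rewrite ge0_symfun_integralT//; last by move=> x; rewrite /h /= normrN.
rewrite EFinM; congr (_ * _)%E.
rewrite -set_itvcy.
transitivity (\int[mu]_(w in `[0%R, +oo[) (expR (- e * w) * (1 + cos (u * w)))%:E)%E.
  by apply: eq_integral => x; rewrite inE/= in_itv/= andbT => x0; rewrite /h ger0_norm.
(* The two zeros are the left endpoint and the limit of [F] at infinity; the value of the integral
   is [- F 0]. *)
rewrite (@ge0_continuous_FTC2y _ _ F 0 0)//.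
- by rewrite /F /g !mulr0 expR0 sin0 cos0 mulr0 mul1r mulr1 sub0r -EFinB sub0r -opprD opprK.
- by apply: continuous_subspaceT; exact: continuous_h0.
- apply: cvg_at_right_filter; apply: differentiable_continuous.
  by apply/derivable1_diffP; case: (is_derive_F 0).
- by move=> x _; rewrite derive1E; case: (is_derive_F x).
Qed.

Lemma integral_expR_cos :
  (\int[mu]_w (expR (- e * `|w|) * (1 + cos (u * `|w|)))%:E = (2 * (e / D + e^-1))%:E)%E.
Proof. exact: integral_h. Qed.

Lemma continuous_expR_cos :
  continuous (fun w : R => expR (- e * `|w|) * (1 + cos (u * `|w|))).
Proof. exact: continuous_h. Qed.

End poisson_kernel.

Section poisson_fourier.
Context (R : realType).
Local Notation mu := (@lebesgue_measure R).
Variable e : R.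
Hypothesis e0 : 0 < e.

Lemma measurable_expR_normr : measurable_fun setT (fun w : R => expR (- e * `|w|)).
Proof.
by apply: measurableT_comp => //; apply: measurable_funM.
Qed.

(** The case [u = 0] of [integral_expR_cos], where the integrand is twice the exponential. *)
Lemma integral_expR_normr : (\int[mu]_w (expR (- e * `|w|))%:E = (2 / e)%:E)%E.
Proof.
have := integral_expR_cos 0 e0.
under eq_integral do rewrite mul0r cos0 mulrC (_ : 1 + 1 = 2%:R :> R)// EFinM.
rewrite ge0_integralZl//; last exact: (measurableEFin measurable_expR_normr).
rewrite expr0n/= addr0 => /(congr1 (fun z => (2^-1)%:E * z)%E).
rewrite muleA -!EFinM mulVf// mul1e => ->; congr (_%:E).
by field; rewrite gt_eqF.
Qed.

Lemma integrable_expR_normr : mu.-integrable setT (fun w : R => (expR (- e * `|w|))%:E).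
Proof.
apply/integrableP; split; first exact: (measurableEFin measurable_expR_normr).
under eq_integral do rewrite /= ger0_norm ?expR_ge0//.
by rewrite integral_expR_normr ltry.
Qed.

Let f (u w : R) : R[i] := (expR (- e * `|w|))%:C * expi (- (u * w)).

Lemma cintegrable_poisson (u : R) : cintegrable mu setT (f u).
Proof.
rewrite /f; apply: (@cintegrableM_bounded _ _ _ _ _ _ _ _ 1) => //.
- by split; [exact: integrable_expR_normr|exact: integrable0].
- by apply: cmeasurable_expi; apply: measurable_funN; exact: measurable_funM.
- by move=> w _; rewrite normc_expi.
Qed.

(** The substitution of [- w] for [w] shows that the integral equals its own conjugate, so the
    imaginary part vanishes. The real part is the integral with [1 + cos] minus the integral with
    1. *)
Lemma cintegral_poisson (u : R) :
  cintegral mu setT (fun w => (expR (- e * `|w|))%:C * expi (- (u * w))) =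
  (2 * (e / (e ^+ 2 + u ^+ 2)))%:C.
Proof.
have if_ := cintegrable_poisson u.
have fJ : conjc (cintegral mu setT (f u)) = cintegral mu setT (f u).
  rewrite -cintegralJ//.
  have := @cintegral_affine R (-1) 0 _ _ if_; rewrite normrN normr1 invr1 mul1r => <-.
    apply: eq_cintegral => w _; rewrite /f mulN1r addr0 normrN mulrN opprK.
    by rewrite conjcM -expiN opprK conjc_real.
  by rewrite oppr_eq0 oner_eq0.
rewrite -/(f u); apply: complexP; last first.
  by move: fJ => /(congr1 (@complex.Im R)); rewrite ImJ => /eqP; rewrite eq_sym -addr_eq0 -mulr2n mulrn_eq0/= => /eqP.
have ih : mu.-integrable setT (fun w => (expR (- e * `|w|) * (1 + cos (u * `|w|)))%:E).
  apply/integrableP; split.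
    by apply: measurableEFin; apply: continuous_measurable_fun; exact: continuous_expR_cos.
  under eq_integral do rewrite /= ger0_norm ?mulr_ge0 ?expR_ge0// -?lerBlDl ?sub0r ?cos_geN1//.
  by rewrite integral_expR_cos// ltry.
have cosA (y : R) : cos (u * `|y|) = cos (u * y).
  by case: (ger0P y) => // _; rewrite mulrN cosN.
rewrite /cintegral /=.
transitivity (Rintegral mu setT (fun w => expR (- e * `|w|) * (1 + cos (u * `|w|)) - expR (- e * `|w|))).
  apply: eq_Rintegral => w _; rewrite mul0r subr0 cosN mulrDr mulr1 addrAC subrr add0r.
  by rewrite cosA.
rewrite RintegralB//; last exact: integrable_expR_normr.
rewrite /Rintegral integral_expR_cos// integral_expR_normr /=.
by field; rewrite !gt_eqF// ltr_pwDl ?exprn_gt0 ?sqr_ge0.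
Qed.

End poisson_fourier.

(** * Criteria for convergence in L^2 *)

Section L2_convergence.
Context (d : measure_display) (T : measurableType d) (R : realType).
Variable mu : {measure set T -> \bar R}.

Lemma cLnorm2_cvg0 (v : nat -> T -> R[i]) :
  (fun n => \int[mu]_x (normc (v n x) ^+ 2)%:E)%E @ \oo --> (0 : \bar R) ->
  (fun n => cLnorm mu 2%:E (v n)) @ \oo --> (0 : \bar R).
Proof.
move=> /cvge0P v0; apply/cvge0P => [n|eps eps0]; first exact: cLnorm_ge0.
have [|N NP] := v0 _ (eps ^+ 2) (exprn_gt0 _ eps0).
  by move=> n; apply: integral_ge0 => x _; rewrite lee_fin sqr_ge0.
by exists N => n Nn; rewrite cLnorm2_leP; [exact: NP|exact: ltW].
Qed.

Lemma cLp2_cvgP (u : nat -> T -> R[i]) (f : T -> R[i]) : cLp_cvg mu 2%:E u f <->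
  (forall eps : R, 0 < eps -> exists N, forall n, (N <= n)%N ->
    (cLnorm mu 2%:E (fun x => u n x - f x)%R <= eps%:E)%E).
Proof. by apply: cvge0P => n; exact: cLnorm_ge0. Qed.

Lemma cLnorm2Z (c : R[i]) (f : T -> R[i]) : cmeasurable setT f ->
  (cLnorm mu 2%:E (fun x => c * f x)%R = (normc c)%:E * cLnorm mu 2%:E f)%E.
Proof.
move=> mf; rewrite !cLnorm2E.
under eq_integral do rewrite ComplexField.Normc.normcM exprMn EFinM.
rewrite ge0_integralZl ?lee_fin ?sqr_ge0//; last 2 first.
- exact: measurable_normc_sqrE.
- by move=> x _; rewrite lee_fin sqr_ge0.
rewrite poweRM ?lee_fin ?sqr_ge0//; last by apply: integral_ge0 => x _; rewrite lee_fin sqr_ge0.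
by rewrite poweR_EFin powR12_sqrt ?sqr_ge0// sqrtr_sqr ger0_norm ?normc_ge0.
Qed.

(** Domination is asked of the difference, so that dominated convergence applies to the squares
    [|u n - f|^2] with limit 0. *)
Lemma cLp_cvg_dominated (u : nat -> T -> R[i]) (f G : T -> R[i]) :
  (forall n, cmeasurable setT (u n)) -> cmeasurable setT f -> cLp mu 2%:E G ->
  (forall n x, normc (u n x - f x) <= normc (G x)) ->
  (forall x, ccvg (u ^~ x) (f x)) -> cLp_cvg mu 2%:E u f.
Proof.
move=> mu_ mf /cLp2P[mG Gy] ufG uf; apply: cLnorm2_cvg0.
have [] // := @dominated_convergence _ _ _ mu setT measurableT
  (fun n x => (normc (u n x - f x) ^+ 2)%:E) (fun=> 0%E) (fun x => (normc (G x) ^+ 2)%:E).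
- by move=> n; apply: measurable_normc_sqrE; exact: cmeasurableB.
- apply: aeW => x _; rewrite (_ : 0%E = (0 * 0 : R)%:E) ?mulr0//.
  apply: cvg_EFin; first exact: nearW.
  rewrite (_ : fine \o _ = (fun n => normc (u n x - f x) * normc (u n x - f x))).
    by rewrite -[X in _ --> X](mulr0 (0 : R)); apply: cvgM; exact: uf.
  by apply/funext => n; rewrite /= expr2.
- apply/integrableP; split; first exact: measurable_normc_sqrE.
  by under eq_integral do rewrite /= ger0_norm ?sqr_ge0//.
- by apply: aeW => x n _; rewrite /= ger0_norm ?sqr_ge0// lee_fin ler_sqr ?nnegrE ?normc_ge0.
- by move=> _ _; rewrite integral0.
Qed.

End L2_convergence.

(** * Continuity of translations in L^2 *)

Section translation_continuity.
Context (R : realType).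
Local Notation mu := (@lebesgue_measure R).
Local Notation L2 f := (cLp mu 2%:E f).
Local Notation N2 f := (cLnorm mu 2%:E f).
Implicit Types (f g : R -> R[i]).

(** Continuity of translation at [f], stated along sequences because the dominated convergence
    theorem is sequential. *)
Definition shift_cvg f : Prop := forall s : nat -> R, s @ \oo --> (0 : R) ->
  cLp_cvg mu 2%:E (fun n x => f (x + s n)) f.

Let cLp2_shift f (s : R) : L2 f -> L2 (fun x => f (x + s)).
Proof.
move=> lf; under [X in L2 X]eq_fun do rewrite -[X in X + s]mul1r.
by apply: cLp2_affine => //; exact: oner_neq0.
Qed.

Let cLnorm2_shift f (s : R) : cmeasurable setT f -> N2 (fun x => f (x + s)) = N2 f.
Proof.
move=> mf; under [X in N2 X]eq_fun do rewrite -[X in X + s]mul1r.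
rewrite cLnorm2_affine//.
by rewrite normr1 sqrtr1 invr1 mul1e.
Qed.

(** A three-epsilon argument: translation preserves the norm, so replacing [f] by [u k] costs the
    same before and after the shift. *)
Lemma shift_cvg_closed (u : nat -> R -> R[i]) f : (forall n, L2 (u n)) -> L2 f ->
  cLp_cvg mu 2%:E u f -> (forall n, shift_cvg (u n)) -> shift_cvg f.
Proof.
move=> lu lf uf su s s0; apply/cLp2_cvgP => eps eps0.
have eps3 : 0 < eps / 3%:R by rewrite divr_gt0.
have [k /(_ k (leqnn k)) uk] := (cLp2_cvgP _ _ _).1 uf _ eps3.
have [N NP] := (cLp2_cvgP _ _ _).1 (su k _ s0) _ eps3.
exists N => n Nn; rewrite (_ : eps = eps / 3%:R + (eps / 3%:R + eps / 3%:R)); last by field.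
have lfs := cLp2_shift (s n) lf; have lus := cLp2_shift (s n) (lu k).
apply: le_trans (cLnorm2_triangle lfs lus lf) _; rewrite [leRHS]EFinD; apply: leeD.
  rewrite (@cLnorm2_shift (fun x => f x - u k x)); first by rewrite cLnorm_distC.
  exact: (cLp2B lf (lu k)).1.
apply: le_trans (cLnorm2_triangle lus (lu k) lf) _; rewrite [leRHS]EFinD; apply: leeD => //.
exact: NP.
Qed.

Lemma shift_cvg_linear f g (c : R[i]) : L2 f -> L2 g -> shift_cvg f -> shift_cvg g ->
  shift_cvg (fun x => f x + c * g x).
Proof.
move=> lf lg sf sg s s0.
have h : (fun n => N2 (fun x => f (x + s n) - f x)%R +
    (normc c)%:E * N2 (fun x => g (x + s n) - g x)%R)%E @ \oo --> (0 : \bar R).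
  rewrite -[X in _ --> X]adde0; apply: cvgeD => //; first exact: sf.
  by rewrite -(mule0 (normc c)%:E); apply: cvgeZl => //; exact: sg.
apply: (squeeze_cvge _ (cvg_cst 0%E) h); apply: nearW => n; rewrite cLnorm_ge0 /=.
have mfs := (cLp2B (cLp2_shift (s n) lf) lf).1; have mgs := (cLp2B (cLp2_shift (s n) lg) lg).1.
rewrite -cLnorm2Z//.
apply: le_trans (cLnormD2 mu mfs (cmeasurableM (cmeasurable_cst _ c) mgs)).
rewrite le_eqVlt; apply/orP; left; apply/eqP/eq_cLnorm => x; congr (normc _); ring.
Qed.

Lemma cLp2_indic_itv (a b : R) : L2 (fun x => (\1_(`[a, b]%classic) x)%:C).
Proof.
apply/cLp2P; split; first exact/cmeasurable_realC/measurable_indic.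
have -> : (fun x : R => (normc (\1_(`[a, b]%classic) x : R)%:C ^+ 2)%:E) =
    (fun x : R => (\1_(`[a, b]%classic) x)%:E).
  apply/funext => x; rewrite normc_real ger0_norm//; congr (_%:E).
  by rewrite indicE; case: (_ \in _); rewrite ?expr1n ?expr0n.
have -> : (\int[mu]_x (\1_(`[a, b]%classic) x)%:E = mu `[a, b]%classic)%E.
  by rewrite integral_indic// setIT.
rewrite lebesgue_measure_itv/=; case: ifP => _; last exact: ltry.
by rewrite -EFinB ltry.
Qed.

Lemma indic_itvNN (L x : R) : \1_(`[- L, L]%classic) x = ((`|x| <= L)%R)%:R :> R.
Proof. by rewrite indicE mem_setE in_itv/= -ler_norml. Qed.

Let cLp2_bounded_support (a : R -> R) (K L : R) : measurable_fun setT a ->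
  (forall x, `|a x| <= K) -> (forall x, L < `|x| -> a x = 0) -> L2 (fun x => (a x)%:C).
Proof.
move=> ma aK aL; apply: (cLp2_le (M := K) (cLp2_indic_itv (- L) L)); first exact: cmeasurable_realC.
move=> x; rewrite !normc_real indic_itvNN.
case: (leP `|x| L) => [xL|/aL ->]; first by rewrite normr1 mulr1.
by rewrite !normr0 mulr0.
Qed.

Lemma shift_cvg_continuous (g : R -> R) (K L : R) : continuous g ->
  (forall x, `|g x| <= K) -> (forall x, L < `|x| -> g x = 0) ->
  shift_cvg (fun x => (g x)%:C).
Proof.
move=> cg gK gL s s0; have mg : measurable_fun setT g by exact: continuous_measurable_fun.
have [S S0 sS] : exists2 S : R, 0 <= S & forall n, `|s n| <= S.
  have [S [_ SP]] := cvg_seq_bounded (cvgP _ s0).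
  exists (`|S| + 1) => [|n]; first by rewrite addr_ge0.
  by apply: SP => //; rewrite ltr_pwDr// ler_norm.
have K0 : 0 <= K by exact: le_trans (gK 0).
have cgs (x : R) : (fun n => g (x + s n)) @ \oo --> g x.
  have h : (fun n => x + s n) @ \oo --> x.
    by rewrite -[X in _ --> X]addr0; apply: cvgD => //; exact: cvg_cst.
  by apply: (@cvg_comp _ _ _ (fun n => x + s n) g _ _ _ h); exact: cg.
(* All shifts are bounded by [S], so every difference is supported in the interval of radius
   [L + S], where it is at most [2 * K]. *)
apply: (@cLp_cvg_dominated _ _ R mu _ _
  (fun x : R => (2 * K)%:C * (\1_(`[- (L + S), L + S]%classic) x : R)%:C)).
- move=> n; apply: cmeasurable_realC; apply: (measurableT_comp mg).
  exact: measurable_funD.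
- exact: cmeasurable_realC.
- apply: (cLp2_le (M := 2 * K) (cLp2_indic_itv (- (L + S)) (L + S))).
    apply: cmeasurableM; first exact: cmeasurable_cst.
    exact/cmeasurable_realC/measurable_indic.
  by move=> x; rewrite ComplexField.Normc.normcM normc_real ger0_norm ?mulr_ge0.
- move=> n x; rewrite -rmorphB ComplexField.Normc.normcM !normc_real indic_itvNN.
  case: (leP `|x| (L + S)) => [xL|xL].
    rewrite normr1 mulr1 [leRHS]ger0_norm ?mulr_ge0// (le_trans (ler_normB _ _))// mulr_natl mulr2n.
    exact: lerD.
  rewrite !gL ?subrr ?normr0 ?mulr0//; first by rewrite (le_lt_trans _ xL)// lerDl.
  rewrite -(ltrD2r S); apply: lt_le_trans xL _.
  rewrite -{1}(addrK (s n) x) (le_trans (ler_normB _ _))// lerD2l.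
  exact: sS.
- move=> x; rewrite /ccvg.
  under eq_fun do rewrite -rmorphB normc_real.
  rewrite -(normr0 R) -(subrr (g x)); apply: cvg_norm; apply: cvgB; last exact: cvg_cst.
  exact: cgs.
Qed.

(** Continuous functions approximate [a] in L^1 on a bounded interval. Clamping their values makes
    the error bounded, which upgrades L^1 to L^2, and a cutoff gives them compact support, so that
    [shift_cvg_continuous] applies. *)
Lemma shift_cvg_bounded (a : R -> R) (M : R) : measurable_fun setT a -> 0 < M ->
  (forall x, `|a x| <= M) -> (forall x, M < `|x| -> a x = 0) ->
  L2 (fun x => (a x)%:C) /\ shift_cvg (fun x => (a x)%:C).
Proof.
move=> ma M0 aM aL; have la := cLp2_bounded_support ma aM aL; split => //.
pose E : set R := `[- (M + 1), M + 1]%classic.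
have mE : measurable E by exact: measurable_itv.
have Ey : (mu E < +oo)%E by rewrite lebesgue_measure_itv/=; case: ifP => _; rewrite -?EFinB ltry.
have ia : mu.-integrable E (EFin \o a).
  apply: measurable_bounded_integrable => //; first exact: measurable_funTS.
  exists M; split; first exact: num_real.
  by move=> y My x _ /=; rewrite (le_trans (aM x))// ltW.
have [phi [cphi iphi phia]] := approximation_continuous_integrable mE Ey ia.
(* Clamping to [[- M, M]] never increases the distance to a value of [a]. The trapezoid [chi] is 1
   on the support of [a] and 0 outside [E]. *)
pose clamp (y : R) : R := Num.max (- M) (Num.min M y).
pose chi (x : R) : R := Num.max 0 (Num.min 1 (M + 1 - `|x|)).
pose g n (x : R) : R := clamp (phi n x) * chi x.
have clampM y : `|clamp y| <= M.
  rewrite /clamp ler_norml; rewrite le_max lexx/= ge_max ge_min lexx/= andbT.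
  by lra.
have clampB y z : `|z| <= M -> `|clamp y - z| <= `|y - z|.
  rewrite /clamp ler_norml => /andP[z1 z2]; rewrite /Num.max /Num.min.
  have n1 := ler_norm (y - z); have := ler_norm (z - y); rewrite distrC => n2.
  by case: (ltP M y) => h1; case: ltP => h2; rewrite ler_norml; apply/andP; split; lra.
have chi01 x : 0 <= chi x <= 1.
  by rewrite /chi le_max lexx/= ge_max ler01/= ge_min lexx.
have chi1 x : `|x| <= M -> chi x = 1.
  by move=> xM; rewrite /chi min_l ?max_r//; lra.
have chi0 x : M + 1 < `|x| -> chi x = 0.
  move=> xM; rewrite /chi max_l// ge_min; apply/orP; right; lra.
have cg n : continuous (g n).
  have cM : continuous (cst (- M) : R -> R) by exact: cst_continuous.
  have cc : continuous (fun x => clamp (phi n x)).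
    move=> x; apply: (@continuous_max R R (cst (- M)) (cst M \min phi n)); first exact: cvg_cst.
    by apply: (@continuous_min R R (cst M) (phi n)); [exact: cvg_cst|exact: cphi].
  have cchi : continuous chi.
    move=> x; apply: (@continuous_max R R (cst 0) (cst 1 \min (fun x => M + 1 - `|x|))); first exact: cvg_cst.
    apply: (@continuous_min R R (cst 1) (fun x => M + 1 - `|x|)); first exact: cvg_cst.
    by apply: cvgB; [exact: cvg_cst|exact: norm_continuous].
  by move=> x; apply: cvgM; [exact: cc|exact: cchi].
have gM n x : `|g n x| <= M.
  have /andP[c0 c1] := chi01 x.
  rewrite /g normrM (ger0_norm c0) -[leRHS]mulr1; exact: ler_pM.
have gL n x : M + 1 < `|x| -> g n x = 0 by move=> /chi0; rewrite /g => ->; rewrite mulr0.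
apply: (@shift_cvg_closed (fun n x => (g n x)%:C)) => //.
- move=> n; apply: cLp2_bounded_support (gM n) (gL n).
  exact: continuous_measurable_fun.
- apply: cLnorm2_cvg0.
  (* Both [g n] and [a] are bounded by [M], hence [|g n - a|^2 <= 2 * M * |g n - a|]. *)
  have h : (fun n => (2 * M)%:E * \int[mu]_(z in E) `|(a z - phi n z)%:E|)%E @ \oo --> (0 : \bar R).
    by rewrite -(mule0 (2 * M)%:E); apply: cvgeZl.
  apply: (squeeze_cvge _ (cvg_cst 0%E) h); apply: nearW => n.
  apply/andP; split; first by apply: integral_ge0 => x _; rewrite lee_fin sqr_ge0.
  have mphi : measurable_fun setT (phi n) by exact: continuous_measurable_fun.
  have mae : measurable_fun E (fun z => `|(a z - phi n z)%:E|%E).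
    apply: measurable_funTS; apply: measurableT_comp => //; apply: measurableEFin.
    exact: measurable_funB.
  rewrite -ge0_integralZl//; last by rewrite lee_fin mulr_ge0// ltW.
  rewrite [leRHS]integral_mkcond; apply: ge0_le_integral => //.
  + by move=> x _; rewrite lee_fin sqr_ge0.
  + apply: measurable_normc_sqrE; apply: cmeasurableB; apply: cmeasurable_realC => //.
    exact: continuous_measurable_fun.
  + by apply/(measurable_restrictT _ mE); exact: measurable_funeM.
  + move=> x _; rewrite patchE -rmorphB normc_real; case: ifPn => xE; last first.
      have xM : M + 1 < `|x|.
        by rewrite ltNge; move: xE; rewrite mem_setE/= in_itv/= -ler_norml.
      by rewrite gL// aL ?subrr ?normr0 ?expr0n//; lra.
    rewrite abse_EFin -EFinM lee_fin expr2.
    (* Where [chi] may differ from 1, [a] vanishes, and multiplying by [chi] only shrinks the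
       clamped value. *)
    have gx : `|g n x - a x| <= `|a x - phi n x|.
      rewrite distrC (distrC (a x) (phi n x)) /g.
      case: (leP `|x| M) => xM; first by rewrite chi1// mulr1 distrC clampB.
      rewrite aL// subr0 sub0r normrN normrM; have /andP[c0 c1] := chi01 x.
      have := clampB (phi n x) 0; rewrite normr0 !subr0 => /(_ (ltW M0)) h0.
      by rewrite -[leRHS]mulr1; apply: ler_pM => //; rewrite ger0_norm.
    apply: ler_pM => //.
    by rewrite (le_trans (ler_normB _ _))// mulr_natl mulr2n lerD.
- by move=> n; exact: shift_cvg_continuous (cg n) (gM n) (gL n).
Qed.

Lemma shift_cvg_real (a : R -> R) : L2 (fun x => (a x)%:C) -> shift_cvg (fun x => (a x)%:C).
Proof.
move=> la; have ma : measurable_fun setT a by case: la.1.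
(* Truncation in space and in value at the same level, as [shift_cvg_bounded] has one bound for
   both; levels start at 1 because that bound is positive. *)
pose I n : set R := `[- n.+1%:R, n.+1%:R]%classic.
pose b n x : R := a x * (\1_(I n) x * \1_(I n) (a x)).
have bE n x : b n x = if (`|x| <= n.+1%:R) && (`|a x| <= n.+1%:R) then a x else 0.
  by rewrite /b !indic_itvNN -natrM mulnb; case: ifP => _; rewrite ?mulr1 ?mulr0.
have mb n : measurable_fun setT (b n).
  apply: measurable_funM => //; apply: measurable_funM.
    by apply: measurable_indic; exact: measurable_itv.
  have mI : measurable_fun setT (\1_(I n) : R -> R).
    by apply: measurable_indic; exact: measurable_itv.
  exact: (measurableT_comp mI ma).
have bP n : L2 (fun x => (b n x)%:C) /\ shift_cvg (fun x => (b n x)%:C).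
  apply: (@shift_cvg_bounded _ n.+1%:R) => // x.
    by rewrite bE; case: ifP => [/andP[]//|_]; rewrite normr0.
  by rewrite bE => xn; rewrite leNgt xn.
apply: (@shift_cvg_closed (fun n x => (b n x)%:C)) => //;
  [by move=> n; case: (bP n)| |by move=> n; case: (bP n)].
apply: (cLp_cvg_dominated _ la.1 la).
- by move=> n; case: (bP n) => -[].
- move=> n x; rewrite -rmorphB !normc_real bE; case: ifP => _; first by rewrite subrr normr0.
  by rewrite sub0r normrN.
- move=> x; apply/cvgr0Pnorm_le => eps eps0.
  have h (y : R) : \forall n \near \oo, y <= n.+1%:R.
    by apply: filterS (nbhs_infty_ger y) => m /le_trans; apply; rewrite ler_nat.
  near=> n.
  have xa : (`|(x : R)| <= n.+1%:R) && (`|a x| <= n.+1%:R).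
    by apply/andP; split; near: n; exact: h.
  by rewrite bE xa subrr ComplexField.Normc.normc0 normr0 ltW.
Unshelve. all: by end_near. Qed.

Lemma cLp2_shift_cvg f : L2 f -> shift_cvg f.
Proof.
move=> lf.
have lRe : L2 (fun x => (complex.Re (f x))%:C).
  apply: (cLp2_le (M := 1) lf); first by apply: cmeasurable_realC; case: lf.1.
  by move=> x; rewrite normc_real mul1r ler_Re_normc.
have lIm : L2 (fun x => (complex.Im (f x))%:C).
  apply: (cLp2_le (M := 1) lf); first by apply: cmeasurable_realC; case: lf.1.
  by move=> x; rewrite normc_real mul1r ler_Im_normc.
rewrite (_ : f = (fun x => (complex.Re (f x))%:C + 'i * (complex.Im (f x))%:C)).
  by apply: shift_cvg_linear => //; exact: shift_cvg_real.
by apply/funext => x; rewrite -complexE.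
Qed.

End translation_continuity.

(** * Measurability and integrability of integrals with a parameter *)

Section parametric_integrals.
Context (d1 d2 : measure_display) (T1 : measurableType d1) (T2 : measurableType d2)
  (R : realType).
Variables (m1 : {sigma_finite_measure set T1 -> \bar R})
  (m2 : {sigma_finite_measure set T2 -> \bar R}).

(** Tonelli handles the positive and the negative part separately; this covers sections that are not
    integrable, on which [fine] of the difference is still a measurable function of [x]. *)
Lemma measurable_Rintegral_param (k : T1 * T2 -> R) : measurable_fun setT k ->
  measurable_fun setT (fun x => Rintegral m2 setT (fun y => k (x, y))).
Proof.
move=> mk; have mk' : measurable_fun setT (EFin \o k) by exact: measurableEFin.
rewrite (_ : (fun x => _) = fine \o (fun x =>
    (fubini_F m2 (EFin \o k)^\+ x) - (fubini_F m2 (EFin \o k)^\- x))%E).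
  apply: measurableT_comp => //; apply: emeasurable_funB.
  - by apply: measurable_fun_fubini_tonelli_F => //; exact: measurable_funepos.
  - by apply: measurable_fun_fubini_tonelli_F => //; exact: measurable_funeneg.
apply/funext => x; rewrite /Rintegral /= integralE /fubini_F.
congr (fine (_ - _)%E); apply: eq_integral => y _.
- by rewrite -[RHS]/(((EFin \o k)^\+ \o (pair x))%E y) -funepos_comp.
- by rewrite -[RHS]/(((EFin \o k)^\- \o (pair x))%E y) -funeneg_comp.
Qed.

Lemma cmeasurable_cintegral_param (K : T1 * T2 -> R[i]) : cmeasurable setT K ->
  cmeasurable setT (fun x => cintegral m2 setT (fun y => K (x, y))).
Proof.
move=> [k1 k2]; split; first exact: (measurable_Rintegral_param k1).
exact: (measurable_Rintegral_param k2).
Qed.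

Lemma cintegrable_fubini21 (K : T1 * T2 -> R[i]) : cintegrable (m1 \x m2)%E setT K ->
  cintegrable m2 setT (fun y => cintegral m1 setT (fun x => K (x, y))).
Proof. by move=> [/integrable_Rintegral21[? _] /integrable_Rintegral21[? _]]. Qed.

Lemma cintegrable_tensor (K : T1 * T2 -> R[i]) (f : T1 -> R[i]) (g : T2 -> R[i]) :
  cintegrable m1 setT f -> cintegrable m2 setT g -> cmeasurable setT K ->
  (forall x y, normc (K (x, y)) <= normc (f x) * normc (g y)) ->
  cintegrable (m1 \x m2)%E setT K.
Proof.
move=> if_ ig mK Kfg; apply: cintegrable_prod => //.
have [mf fy] := (cintegrableP _ measurableT _).1 if_.
have [mg gy] := (cintegrableP _ measurableT _).1 ig.
set A := (\int[m1]_x (normc (f x))%:E)%E in fy; set B := (\int[m2]_x (normc (g x))%:E)%E in gy.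
have B0 : (0 <= B)%E by apply: integral_ge0 => y _; rewrite lee_fin normc_ge0.
have A0 : (0 <= A)%E by apply: integral_ge0 => y _; rewrite lee_fin normc_ge0.
have Afin : A \is a fin_num by rewrite ge0_fin_numE.
have Bfin : B \is a fin_num by rewrite ge0_fin_numE.
have mnf := measurable_normcE mf; have mng := measurable_normcE mg.
have mnK := measurable_normcE mK.
apply: (@le_lt_trans _ _ (\int[m1]_x ((normc (f x))%:E * B))%E); last first.
  rewrite ge0_integralZr//; first exact: lte_mul_pinfty.
  by move=> x _; rewrite lee_fin normc_ge0.
apply: ge0_le_integral => //.
- by move=> x _; apply: integral_ge0 => y _; rewrite lee_fin normc_ge0.
- by apply: (measurable_fun_fubini_tonelli_F (fun xy => (normc (K xy))%:E)) => // xy; rewrite lee_fin normc_ge0.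
- by apply: emeasurable_funM.
- move=> x _; rewrite -ge0_integralZl//; last 2 first.
  + by move=> y _; rewrite lee_fin normc_ge0.
  + by rewrite lee_fin normc_ge0.
  apply: ge0_le_integral => //.
  + by move=> y _; rewrite lee_fin normc_ge0.
  + exact: (measurable_fun_pair2 _ mnK).
  + exact: measurable_funeM.
  + by move=> y _; rewrite -EFinM lee_fin.
Qed.

End parametric_integrals.

(** * Fourier transform, convolution and Plancherel's identity *)

Section fourier.
Context (R : realType).
Local Notation mu := (@lebesgue_measure R).
Local Notation L1 f := (cintegrable mu setT f).
Local Notation L2 f := (cLp mu 2%:E f).
Implicit Types (f g : R -> R[i]).

Definition fourier f (w : R) : R[i] := cintegral mu setT (fun x => f x * expi (- (w * x))).

Definition convolution f g (t : R) : R[i] := cintegral mu setT (fun x => f x * g (t - x)).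

Let cmeasurable_char (w : R) : cmeasurable setT (fun x : R => expi (- (w * x))).
Proof. by apply: cmeasurable_expi; apply: measurable_funN; exact: measurable_funM. Qed.

Lemma cintegrable_fourier f (w : R) : L1 f -> L1 (fun x => f x * expi (- (w * x))).
Proof.
move=> lf; apply: (@cintegrableM_bounded _ _ _ _ _ _ _ _ 1) => //.
  exact: cmeasurable_char.
by move=> x _; rewrite normc_expi.
Qed.

Lemma cmeasurable_fourier f : cmeasurable setT f -> cmeasurable setT (fourier f).
Proof.
move=> mf; refine (@cmeasurable_cintegral_param _ _ (measurableTypeR R) (measurableTypeR R) R mu
  (fun wx => f wx.2 * expi (- (wx.1 * wx.2))) _).
apply: cmeasurableM; first exact: (cmeasurableT_comp mf).
by apply: cmeasurable_expi; apply: measurable_funN; exact: measurable_funM.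
Qed.

Lemma normc_fourier_le f (w : R) : L1 f ->
  normc (fourier f w) <= Rintegral mu setT (fun x => normc (f x)).
Proof.
move=> lf; have := normc_cintegral_le measurableT (cintegrable_fourier w lf).
under eq_integral do rewrite ComplexField.Normc.normcM normc_expi mulr1.
rewrite -lee_fin /Rintegral fineK//.
exact: integrable_fin_num (cintegrable_normc measurableT lf).
Qed.

Lemma cmeasurable_conv f g : cmeasurable setT f -> cmeasurable setT g ->
  cmeasurable setT (convolution f g).
Proof.
move=> mf mg; refine (@cmeasurable_cintegral_param _ _ (measurableTypeR R) (measurableTypeR R) R mu
  (fun tx => f tx.2 * g (tx.1 - tx.2)) _).
apply: cmeasurableM; first exact: (cmeasurableT_comp mf).
by apply: (cmeasurableT_comp mg); exact: measurable_funB.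
Qed.

Let conv_kernel f g : L1 f -> L1 g ->
  cintegrable (mu \x mu)%E setT
    (fun xt : measurableTypeR R * measurableTypeR R => f xt.1 * g (xt.2 - xt.1)).
Proof.
move=> lf lg; have [mf fy] := (cintegrableP _ measurableT _).1 lf.
have [mg gy] := (cintegrableP _ measurableT _).1 lg.
set A := (\int[mu]_x (normc (f x))%:E)%E in fy.
set B := (\int[mu]_x (normc (g x))%:E)%E in gy.
have A0 : (0 <= A)%E by apply: integral_ge0 => y _; rewrite lee_fin normc_ge0.
have B0 : (0 <= B)%E by apply: integral_ge0 => y _; rewrite lee_fin normc_ge0.
have mnf := measurable_normcE mf; have mng := measurable_normcE mg.
apply: cintegrable_prod.
  apply: cmeasurableM; first exact: (cmeasurableT_comp mf measurable_fst).
  apply: (cmeasurableT_comp mg); apply: measurable_funB; first exact: measurable_snd.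
  exact: measurable_fst.
rewrite (_ : (\int[_]_x _)%E = (\int[mu]_x ((normc (f x))%:E * B))%E).
  rewrite ge0_integralZr//; first by apply: lte_mul_pinfty => //; rewrite ge0_fin_numE.
  by move=> x _; rewrite lee_fin normc_ge0.
apply: eq_integral => x _ /=.
under eq_integral do rewrite ComplexField.Normc.normcM EFinM.
have mgx : measurable_fun setT (fun y : R => (normc (g (y - x)))%:E).
  apply: measurable_normcE; apply: (cmeasurableT_comp mg); exact: measurable_funB.
rewrite ge0_integralZl ?lee_fin ?normc_ge0//; last by move=> y _; rewrite lee_fin normc_ge0.
congr (_ * _)%E; transitivity (\int[mu]_y (normc (g (1 * y - x)%R))%:E)%E.
  by apply: eq_integral => y _; rewrite mul1r.
rewrite (@ge0_integral_affine R 1 (- x) (oner_neq0 _) (fun y => (normc (g y))%:E) mng).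
  by rewrite normr1 invr1 mul1e.
by move=> y; rewrite lee_fin normc_ge0.
Qed.

Lemma cintegrable_conv f g : L1 f -> L1 g -> L1 (convolution f g).
Proof. by move=> lf lg; exact: (cintegrable_fubini21 (conv_kernel lf lg)). Qed.

Lemma cLp2_reflect g (t : R) : L2 g -> L2 (fun x => g (t - x)).
Proof.
move=> lg; under [X in L2 X]eq_fun do rewrite addrC -mulN1r.
by apply: cLp2_affine => //; rewrite oppr_eq0 oner_eq0.
Qed.

Lemma cLnorm2_reflect g (t : R) : cmeasurable setT g ->
  cLnorm mu 2%:E (fun x => g (t - x)) = cLnorm mu 2%:E g.
Proof.
move=> mg; under [X in cLnorm _ _ X]eq_fun do rewrite addrC -mulN1r.
rewrite cLnorm2_affine ?oppr_eq0 ?oner_eq0//.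
by rewrite normrN normr1 sqrtr1 invr1 mul1e.
Qed.

Lemma normc_conv_le f g (t : R) : L2 f -> L2 g ->
  ((normc (convolution f g t))%:E <= cLnorm mu 2%:E f * cLnorm mu 2%:E g)%E.
Proof.
move=> lf lg; rewrite -(cLnorm2_reflect t lg.1).
by apply: cauchy_schwarz => //; exact: cLp2_reflect.
Qed.

Lemma cLp2_bounded f (M : R) : L1 f -> (forall x, normc (f x) <= M) -> L2 f.
Proof.
move=> lf fM; have [mf fy] := (cintegrableP _ measurableT _).1 lf.
apply/cLp2P; split => //.
have M0 : 0 <= M by exact: le_trans (normc_ge0 _) (fM 0).
apply: (@le_lt_trans _ _ (\int[mu]_x (M%:E * (normc (f x))%:E))%E).
  apply: ge0_le_integral => //.
  - by move=> x _; rewrite lee_fin sqr_ge0.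
  - exact: measurable_normc_sqrE.
  - by apply: measurable_funeM; exact: measurable_normcE.
  - by move=> x _; rewrite -EFinM lee_fin expr2 ler_wpM2r ?normc_ge0.
rewrite ge0_integralZl ?lee_fin//; first by rewrite lte_mul_pinfty.
- exact: measurable_normcE.
- by move=> x _; rewrite lee_fin normc_ge0.
Qed.

(** The convolution is integrable, and bounded by Cauchy-Schwarz; a bounded integrable function is
    square integrable. *)
Lemma cLp2_conv f g : L1 f -> L2 f -> L1 g -> L2 g -> L2 (convolution f g).
Proof.
move=> f1 f2 g1 g2.
apply: (@cLp2_bounded _ (fine (cLnorm mu 2%:E f * cLnorm mu 2%:E g))).
  exact: cintegrable_conv.
move=> x; rewrite -lee_fin fineK; first exact: normc_conv_le.
by rewrite fin_numM// cLnorm2_fin_num.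
Qed.

(** Fubini and a translation. Through the L^2 hypotheses [x |-> f x * g (t - x)] is integrable for
    every [t], not just almost every one, so the character enters the inner integral at each
    point. *)
Lemma fourier_conv f g (w : R) : L1 f -> L2 f -> L1 g -> L2 g ->
  fourier (convolution f g) w = fourier f w * fourier g w.
Proof.
move=> lf lf2 lg lg2; have lk := conv_kernel lf lg.
have lK : cintegrable (mu \x mu)%E setT (fun xt : measurableTypeR R * measurableTypeR R =>
    f xt.1 * g (xt.2 - xt.1) * expi (- (w * xt.2))).
  apply: (@cintegrableM_bounded _ _ _ _ _ _ _ _ 1) => //.
    apply: cmeasurable_expi; apply: measurable_funN; apply: measurable_funM => //.
  by move=> x _; rewrite normc_expi.
transitivity (cintegral mu setT (fun t => cintegral mu setT (fun x =>
    f x * g (t - x) * expi (- (w * t))))).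
  apply: eq_cintegral => t _; rewrite /convolution mulrC -cintegralZ//.
    by apply: eq_cintegral => x _; rewrite mulrC.
  by apply: cintegrable_mul => //; exact: cLp2_reflect.
rewrite -(cfubini lK) /=.
rewrite [RHS]mulrC /fourier -cintegralZ//; last exact: cintegrable_fourier.
apply: eq_cintegral => x _.
have le : L1 (fun s => g s * expi (- (w * s))) by exact: cintegrable_fourier.
have := cintegral_affine (- x) (oner_neq0 R) (cintegrable_fourier w lg).
rewrite normr1 invr1 mul1r => <-.
rewrite mulrC -cintegralZ; last 2 first.
- exact: measurableT.
- exact: (cintegrable_affine (- x) (oner_neq0 R) le).
apply: eq_cintegral => t _; rewrite mul1r.
rewrite (_ : - (w * t) = - (w * x) + - (w * (t - x))) ?expiD; last by ring.
by ring.
Qed.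

(** The mass of the Poisson kernel at unit scale, and the origin of the [2 * pi] in Plancherel's
    identity. *)
Lemma integral_oneDsqr : (\int[mu]_v (2 / (1 + v ^+ 2))%:E = (2 * pi)%:E)%E.
Proof.
rewrite ge0_symfun_integralT; last 3 first.
- by move=> x; rewrite divr_ge0// addr_ge0// sqr_ge0.
- move=> x; apply: cvgM; first exact: cvg_cst.
  exact: continuous_oneDsqrV.
- by move=> x; rewrite /= sqrrN.
rewrite -set_itvcy; under eq_integral do rewrite EFinM.
rewrite ge0_integralZl//; last 2 first.
- apply: measurable_funTS; apply: measurableEFin; apply: continuous_measurable_fun => x.
  exact: continuous_oneDsqrV.
- by move=> x _; rewrite lee_fin invr_ge0 addr_ge0// sqr_ge0.
rewrite integral0y_oneDsqr -!EFinM; congr (_%:E).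
by field.
Qed.

Lemma integrable_oneDsqr : mu.-integrable setT (fun v : R => (2 / (1 + v ^+ 2))%:E).
Proof.
have h (v : R) : 0 <= 2 / (1 + v ^+ 2) by rewrite divr_ge0// addr_ge0// sqr_ge0.
apply/integrableP; split.
  apply: measurableEFin; apply: continuous_measurable_fun => x.
  by apply: cvgM; [exact: cvg_cst|exact: continuous_oneDsqrV].
under eq_integral do rewrite /= ger0_norm//.
by rewrite integral_oneDsqr ltry.
Qed.

(** The involution that conjugates the Fourier transform: convolving [f] with it gives the
    autocorrelation, whose transform is [|fourier f|^2]. *)
Let flip f (x : R) := conjc (f (- x)).

Let flip_L1 f : L1 f -> L1 (flip f).
Proof.
move=> lf; apply: cintegrableJ => //.
have m10 : (-1 : R) != 0 by rewrite oppr_eq0 oner_eq0.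
have := cintegrable_affine 0 m10 lf.
by under [X in cintegrable _ _ X]eq_fun do rewrite addr0 mulN1r.
Qed.

Let flip_L2 f : L2 f -> L2 (flip f).
Proof.
move=> lf; have m10 : (-1 : R) != 0 by rewrite oppr_eq0 oner_eq0.
have := cLp2_affine 0 m10 lf.
under [X in cLp _ _ X]eq_fun do rewrite addr0 mulN1r.
exact: cLp2J.
Qed.

Let fourier_flip f (w : R) : L1 f -> fourier (flip f) w = conjc (fourier f w).
Proof.
move=> lf; have le := cintegrableJ (cintegrable_fourier w lf).
have m10 : (-1 : R) != 0 by rewrite oppr_eq0 oner_eq0.
rewrite /fourier -cintegralJ//; last exact: cintegrable_fourier.
have := cintegral_affine 0 m10 le.
rewrite normrN normr1 invr1 mul1r => <-.
by apply: eq_cintegral => x _; rewrite /flip addr0 mulN1r conjcM mulrN opprK -expiN.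
Qed.

Lemma sqr_normc_fourier f (w : R) : L1 f -> L2 f ->
  (normc (fourier f w) ^+ 2)%:C = fourier (convolution f (flip f)) w.
Proof.
move=> lf lf2; rewrite fourier_conv//; last 2 first.
- exact: flip_L1.
- exact: flip_L2.
by rewrite fourier_flip// mulcJ.
Qed.

Lemma autocorrE f (t : R) :
  convolution f (flip f) t = cintegral mu setT (fun x => conjc (f (x - t)) * f x).
Proof. by apply: eq_cintegral => x _; rewrite /flip opprB mulrC. Qed.

(** The autocorrelation pairs a translate of [conjc f] with [f], so continuity of translations in
    L^2 suffices. *)
Lemma autocorr_cvg0 f (s : nat -> R) : L2 f -> s @ \oo --> (0 : R) ->
  ccvg (fun n => convolution f (flip f) (s n)) (convolution f (flip f) 0).
Proof.
move=> lf s0; rewrite /ccvg.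
under eq_fun do rewrite !autocorrE.
have fJ := cLp2J lf.
have e0 : cintegral mu setT (fun x => conjc (f (x - 0)) * f x) =
    cintegral mu setT (fun x => conjc (f x) * f x).
  by apply: eq_cintegral => x _; rewrite subr0.
rewrite e0; apply: (cLp_cvg_cintegral _ fJ lf).
  move=> n; apply: cLp2J; under [X in L2 X]eq_fun do rewrite -[X in X - _]mul1r.
  by apply: cLp2_affine => //; exact: oner_neq0.
apply: (cLp2_shift_cvg fJ).
by rewrite -oppr0; exact: cvgN.
Qed.

(** Fubini moves the transform from [c] onto the exponential, which becomes the Poisson kernel of
    width [e]. *)
Lemma fourier_poisson c (e : R) : 0 < e -> L1 c ->
  cintegral mu setT (fun w => (expR (- e * `|w|))%:C * fourier c w) =
  cintegral mu setT (fun v => c (e * v) * (2 / (1 + v ^+ 2))%:C).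
Proof.
move=> e0 lc.
have lE : L1 (fun w : R => (expR (- e * `|w|))%:C).
  by split; [exact: integrable_expR_normr|exact: integrable0].
have lK : cintegrable (mu \x mu)%E setT (fun ws : measurableTypeR R * measurableTypeR R =>
    (expR (- e * `|ws.1|))%:C * (c ws.2 * expi (- (ws.1 * ws.2)))).
  apply: (cintegrable_tensor lE lc).
    apply: cmeasurableM.
      apply: (cmeasurableT_comp (f := fun w : R => (expR (- e * `|w|))%:C)) => //.
      exact: (cintegrable_cmeasurable lE).
    apply: cmeasurableM.
      by apply: (cmeasurableT_comp (f := c)) => //; exact: (cintegrable_cmeasurable lc).
    by apply: cmeasurable_expi; apply: measurable_funN; exact: measurable_funM.
  by move=> w s; rewrite /= !ComplexField.Normc.normcM normc_expi mulr1.
transitivity (cintegral mu setT (fun w => cintegral mu setT (fun s =>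
    (expR (- e * `|w|))%:C * (c s * expi (- (w * s)))))).
  by apply: eq_cintegral => w _; rewrite cintegralZ//; exact: cintegrable_fourier.
rewrite (cfubini lK) /=.
transitivity (cintegral mu setT (fun s => c s * (2 * (e / (e ^+ 2 + s ^+ 2)))%:C)).
  apply: eq_cintegral => s _; rewrite -cintegral_poisson// -cintegralZ//; last exact: cintegrable_poisson.
  by apply: eq_cintegral => w _; rewrite mulrCA (mulrC s).
have en0 : e != 0 by rewrite gt_eqF.
have lck : L1 (fun s => c s * (2 * (e / (e ^+ 2 + s ^+ 2)))%:C).
  have mE : measurable_fun setT (fun s : R => 2 * (e / (e ^+ 2 + s ^+ 2))).
    apply: continuous_measurable_fun => x.
    apply: cvgM; first exact: cvg_cst.
    apply: cvgM; first exact: cvg_cst.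
    apply: cvgV; first by rewrite gt_eqF// ltr_pwDl ?exprn_gt0 ?sqr_ge0.
    by apply: cvgD; [exact: cvg_cst|exact: exprn_continuous].
  apply: (@cintegrableM_bounded _ _ _ _ _ _ _ _ (2 / e)) => //.
  move=> s _; rewrite normc_real ger0_norm; last first.
    by rewrite mulr_ge0// divr_ge0 ?(ltW e0)// addr_ge0// sqr_ge0.
  rewrite ler_pM2l// ler_pdivrMr ?ltr_pwDl ?exprn_gt0 ?sqr_ge0//.
  by rewrite mulrDr expr2 mulKf// lerDl mulr_ge0 ?invr_ge0 ?sqr_ge0// ltW.
(* The substitution [s = e * v] fixes the kernel and leaves [e] only in the argument of [c], ready
   for dominated convergence. *)
have kE (v : R) : e * (2 * (e / (e ^+ 2 + (e * v) ^+ 2))) = 2 / (1 + v ^+ 2).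
  have v0 : 1 + v ^+ 2 != 0 by rewrite gt_eqF// ltr_pwDl ?sqr_ge0.
  rewrite (_ : e ^+ 2 + (e * v) ^+ 2 = e ^+ 2 * (1 + v ^+ 2)); last by ring.
  by field; rewrite en0 v0.
transitivity (e%:C * cintegral mu setT
    (fun v => c (e * v + 0) * (2 * (e / (e ^+ 2 + (e * v + 0) ^+ 2)))%:C)).
  rewrite (cintegral_affine 0 en0 lck) mulrA -rmorphM gtr0_norm//.
  by rewrite divff// mul1r.
rewrite -cintegralZ//; last exact: (cintegrable_affine 0 en0 lck).
apply: eq_cintegral => v _; rewrite addr0 mulrCA -rmorphM; congr (_ * _%:C).
exact: kE.
Qed.

(** Both sides are limits of the energies [J n] damped by [exp (- e n |w|)]: monotone convergence
    gives the left side, and dominated convergence on the autocorrelation [c] gives the right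
    side. *)
Lemma plancherel_energy f : L1 f -> L2 f ->
  (\int[mu]_w (normc (fourier f w) ^+ 2)%:E = (2 * pi)%:E * \int[mu]_x (normc (f x) ^+ 2)%:E)%E.
Proof.
move=> lf lf2; pose c := convolution f (flip f).
have lc : L1 c by apply: cintegrable_conv => //; exact: flip_L1.
pose M := fine (cLnorm mu 2%:E f * cLnorm mu 2%:E (flip f)).
have lfl := flip_L2 lf2.
have cM t : normc (c t) <= M.
  by rewrite -lee_fin fineK ?normc_conv_le// fin_numM// cLnorm2_fin_num.
(* The energy of [f] is its autocorrelation at 0. *)
have c0E : (\int[mu]_x (normc (f x) ^+ 2)%:E)%E = (complex.Re (c 0))%:E.
  rewrite /c autocorrE /= /Rintegral fineK; last first.
    apply: integrable_fin_num => //.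
    have [] := cintegrable_mul (cLp2J lf2) lf2.
    by move=> + _; apply: eq_integrable => // x _; rewrite subr0.
  apply: eq_integral => x _; rewrite subr0 mulrC mulcJ//.
pose k (v : R) := 2 / (1 + v ^+ 2).
pose e n : R := n.+1%:R^-1.
pose J n := (\int[mu]_w (expR (- e n * `|w|) * normc (fourier f w) ^+ 2)%:E)%E.
have e0 n : 0 < e n by rewrite invr_gt0.
have mk : measurable_fun setT (fun v : R => (k v)%:E) := measurable_int _ integrable_oneDsqr.
have k0 v : 0 <= k v by rewrite divr_ge0// addr_ge0// sqr_ge0.
have ckint n : L1 (fun v => c (e n * v) * (k v)%:C).
  have lk : L1 (fun v : R => (k v)%:C) by split; [exact: integrable_oneDsqr|exact: integrable0].
  under [X in L1 X]eq_fun do rewrite mulrC.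
  apply: (@cintegrableM_bounded _ _ _ _ _ _ _ _ M) => //.
  by apply: (cmeasurableT_comp (cintegrable_cmeasurable lc)); exact: measurable_funM.
have Eint n : L1 (fun w : R => (expR (- e n * `|w|))%:C * fourier c w).
  have lE : L1 (fun w : R => (expR (- e n * `|w|))%:C).
    by split; [exact: integrable_expR_normr|exact: integrable0].
  apply: (@cintegrableM_bounded _ _ _ _ _ _ _ _ (Rintegral mu setT (fun x => normc (c x)))) => //.
    exact/cmeasurable_fourier/(cintegrable_cmeasurable lc).
  by move=> x _; exact: normc_fourier_le.
have JE n : J n = (\int[mu]_v (complex.Re (c (e n * v)) * k v)%:E)%E.
  have [i1 _] := Eint n; have [i2 _] := ckint n.
  have e1 : J n = (\int[mu]_w (complex.Re ((expR (- e n * `|w|))%:C * fourier c w))%:E)%E.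
    by apply: eq_integral => w _; rewrite -sqr_normc_fourier// -rmorphM.
  rewrite e1 -(fineK (integrable_fin_num _ i1))// .
  rewrite (_ : fine _ = complex.Re (cintegral mu setT (fun w => (expR (- e n * `|w|))%:C * fourier c w)))//.
  rewrite fourier_poisson//= /Rintegral fineK; last exact: integrable_fin_num.
  by apply: eq_integral => v _; rewrite mulr0 subr0.
have en : e @ \oo --> (0 : R) by exact: cvg_harmonic.
(* [c] is bounded by [M] and continuous at 0, so [M * k] dominates and the limit is [c 0] times the
   mass of [k]. *)
have Jcvg1 : J @ \oo --> ((2 * pi)%:E * (complex.Re (c 0))%:E)%E.
  have -> : J = (fun n => \int[mu]_v (complex.Re (c (e n * v)) * k v)%:E)%E.
    by apply/funext => n; exact: JE.
  have mc := cintegrable_cmeasurable lc.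
  have mkR : measurable_fun setT k by exact/measurable_EFinP.
  have mfn n : measurable_fun setT (fun v : R => (complex.Re (c (e n * v)) * k v)%:E).
    apply: measurableEFin; apply: measurable_funM => //.
    by case: (cmeasurableT_comp (g := fun v : R => e n * v) mc) => //; exact: measurable_funM.
  have mf : measurable_fun setT (fun v : R => (complex.Re (c 0) * k v)%:E).
    by apply: measurableEFin; exact: measurable_funM.
  have ff (v : R) : (fun n => (complex.Re (c (e n * v)) * k v)%:E) @ \oo --> (complex.Re (c 0) * k v)%:E.
    apply: cvg_EFin; first exact: nearW.
    rewrite (_ : fine \o _ = (fun n => complex.Re (c (e n * v)) * k v))//.
    apply: cvgM; last exact: cvg_cst.
    have ev : (fun n => e n * v) @ \oo --> (0 : R).
      by rewrite -(mul0r v); apply: cvgM => //; exact: cvg_cst.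
    apply/subr_cvg0; apply: norm_cvg0.
    apply: (squeeze_cvgr _ (cvg_cst 0) (autocorr_cvg0 lf2 ev)).
    by apply: nearW => n; rewrite normr_ge0 -ReN -ReD; exact: ler_Re_normc.
  have aef : {ae mu, forall (v : R), setT v ->
      (fun n => (complex.Re (c (e n * v)) * k v)%:E) @ \oo --> (complex.Re (c 0) * k v)%:E}.
    by apply: aeW => v _; exact: ff.
  have ig : mu.-integrable setT (fun v : R => (M * k v)%:E).
    by have := integrableZl measurableT M integrable_oneDsqr; apply: eq_integrable => // v _; rewrite EFinM.
  have fg : {ae mu, forall (v : R) n, setT v ->
      (`|(complex.Re (c (e n * v)) * k v)%:E| <= (M * k v)%:E)%E}.
    apply: aeW => v n _; rewrite abse_EFin lee_fin normrM (ger0_norm (k0 v)).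
    by rewrite ler_wpM2r// (le_trans (ler_Re_normc _)).
  have [_ _] := @dominated_convergence _ _ _ mu setT measurableT
    (fun n (v : R) => (complex.Re (c (e n * v)) * k v)%:E)
    (fun v : R => (complex.Re (c 0) * k v)%:E) (fun v : R => (M * k v)%:E) mfn mf aef ig fg.
  rewrite (_ : (\int[mu]_v (complex.Re (c 0) * k v)%:E)%E = ((2 * pi)%:E * (complex.Re (c 0))%:E)%E)//.
  under eq_integral do rewrite EFinM.
  by rewrite integralZl//; [rewrite integral_oneDsqr muleC|exact: integrable_oneDsqr].
(* The sequence [e] decreases to 0, so the damping factors increase to 1. *)
have Jcvg2 : J @ \oo --> (\int[mu]_w (normc (fourier f w) ^+ 2)%:E)%E.
  have := @cvg_monotone_convergence _ _ _ mu setT measurableT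
    (fun n (w : R) => (expR (- e n * `|w|) * normc (fourier f w) ^+ 2)%:E).
  have mF := cmeasurable_fourier lf2.1.
  have lim w : limn (fun n => (expR (- e n * `|w|) * normc (fourier f w) ^+ 2)%:E) =
      (normc (fourier f w) ^+ 2)%:E.
    apply/cvg_lim => //; apply: cvg_EFin; first exact: nearW.
    rewrite (_ : fine \o _ = (fun n => expR (- e n * `|w|) * normc (fourier f w) ^+ 2))//.
    rewrite -[X in _ --> X]mul1r; apply: cvgM; last exact: cvg_cst.
    have ew : (fun n => - e n * `|w|) @ \oo --> (0 : R).
      by rewrite -(mul0r `|w|) -oppr0; apply: cvgM; [exact: cvgN|exact: cvg_cst].
    rewrite -expR0; apply: (@cvg_comp _ _ _ (fun n => - e n * `|w|) expR _ _ _ ew).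
    exact: continuous_expR.
  rewrite (_ : (fun w : R => (normc (fourier f w) ^+ 2)%:E) = (fun w =>
      limn (fun n => (expR (- e n * `|w|) * normc (fourier f w) ^+ 2)%:E))); last first.
    by apply/funext => w; rewrite lim.
  apply.
  - move=> n; apply: measurableEFin; apply: measurable_funM; last exact: measurable_normc_sqr.
    exact: measurable_expR_normr.
  - by move=> n w _; rewrite lee_fin mulr_ge0 ?expR_ge0 ?sqr_ge0.
  - move=> w _ n m nm; rewrite lee_fin ler_wpM2r ?sqr_ge0// ler_expR ler_wpM2r//.
    by rewrite lerN2 lef_pV2 ?posrE// ler_nat.
by rewrite c0E -(cvg_lim _ Jcvg1)// (cvg_lim _ Jcvg2).
Qed.

Lemma plancherel f : L1 f -> L2 f ->
  (cLnorm mu 2%:E (fourier f) = (Num.sqrt (2 * pi))%:E * cLnorm mu 2%:E f)%E.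
Proof.
move=> lf lf2; rewrite !cLnorm2E plancherel_energy// poweRM ?lee_fin ?mulr_ge0 ?pi_ge0//.
  by rewrite poweR_EFin powR12_sqrt// mulr_ge0// pi_ge0.
by apply: integral_ge0 => x _; rewrite lee_fin sqr_ge0.
Qed.

Lemma cLp2_fourier f : L1 f -> L2 f -> L2 (fourier f).
Proof.
move=> lf lf2; split; first exact: cmeasurable_fourier lf2.1.
rewrite plancherel// lte_mul_pinfty// ?lee_fin ?sqrtr_ge0//.
by case: lf2.
Qed.

End fourier.

(** The convention [0^-1 = 0] makes [x^-1 = (x^2)^-1 * x] true everywhere, and real powers are
    measurable. *)
Lemma measurable_invr (R : realType) : measurable_fun setT (fun x : R => x^-1).
Proof.
have -> : (fun x : R => x^-1) = (fun x => powR (x ^+ 2) (-1) * x).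
  apply/funext => x; rewrite powR_inv1 ?sqr_ge0//.
  have [->|x0] := eqVneq x 0; first by rewrite invr0 mulr0.
  by field.
apply: measurable_funM => //.
exact: (measurableT_comp (measurable_powR _) (measurable_funX _ _)).
Qed.

Lemma measurable_sqrtr (R : realType) : measurable_fun setT (@Num.sqrt R).
Proof. by apply: continuous_measurable_fun => x; exact: sqrt_continuous. Qed.

(** * The SAFT and the wavelet transform at a fixed scale in terms of the Fourier transform *)

Section saft_fourier.
Context (R : realType).
Local Notation mu := (@lebesgue_measure R).
Local Notation L1 f := (cintegrable mu setT f).
Local Notation L2 f := (cLp mu 2%:E f).
Local Notation N2 f := (cLnorm mu 2%:E f).
Variables (A B D p q : R).
Implicit Types (f u v : R -> R[i]).
Hypothesis B0 : B != 0.

Let K := normc (K_B B).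

(** The square of the principal root is [2 * pi * B] for either sign of [B], so only [|B|] is left
    in the modulus. *)
Lemma normc_sqr_K_B : K ^+ 2 = (2 * pi * `|B|)^-1.
Proof.
rewrite /K /K_B ComplexField.Normc.normcV exprVn; congr (_^-1).
rewrite expr2 -ComplexField.Normc.normcM -expr2 sqr_sqrtc normc_real.
by rewrite normrM ger0_norm// mulr_ge0// pi_ge0.
Qed.

Lemma normc_K_B_gt0 : 0 < K.
Proof.
rewrite lt_neqAle normc_ge0 andbT eq_sym -sqrf_eq0 normc_sqr_K_B invr_eq0.
by rewrite !mulf_neq0 ?normr_eq0// gt_eqF// pi_gt0.
Qed.

Definition chirp (x : R) : R[i] := expi ((2 * B)^-1 * (A * x ^+ 2 + 2 * x * p)).

Lemma cmeasurable_chirp : cmeasurable setT chirp.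
Proof.
apply: cmeasurable_expi; apply: measurable_funM => //; apply: measurable_funD.
  by apply: measurable_funM => //; exact: measurable_funX.
by apply: measurable_funM => //; exact: measurable_funM.
Qed.

Lemma normc_chirp x : normc (chirp x) = 1.
Proof. exact: normc_expi. Qed.

Lemma chirp_L1 f : L1 f -> L1 (fun x => f x * chirp x).
Proof.
move=> lf; apply: (@cintegrableM_bounded _ _ _ _ _ _ _ _ 1) => //.
  exact: cmeasurable_chirp.
by move=> x _; rewrite normc_chirp.
Qed.

Lemma cLnorm_chirp f : N2 (fun x => f x * chirp x) = N2 f.
Proof. by apply: eq_cLnorm => x; rewrite ComplexField.Normc.normcM normc_chirp mulr1. Qed.

Lemma chirp_L2 f : L2 f -> L2 (fun x => f x * chirp x).
Proof.
move=> [mf fy]; split; last by rewrite cLnorm_chirp.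
by apply: cmeasurableM => //; exact: cmeasurable_chirp.
Qed.

(** In the phase of the kernel the only term mixing [x] and [w] is [- x * w / B], hence the
    frequency [w / B]; the terms in [x] alone form the chirp. *)
Lemma saft_integralE u w : L1 u -> saft_integral A B D p q u w =
  conjc (K_B B) * expi ((2 * B)^-1 * (- 2 * w * (D * p - B * q) + D * w ^+ 2)) *
  fourier (fun x => u x * chirp x) (w / B).
Proof.
move=> lu; rewrite /fourier -cintegralZ//; last exact/cintegrable_fourier/chirp_L1.
apply: eq_cintegral => x _; rewrite /saft_kernel.
rewrite (_ : (2 * B)^-1 * (A * x ^+ 2 + 2 * x * (p - w) - 2 * w * (D * p - B * q) + D * w ^+ 2) =
  (2 * B)^-1 * (- 2 * w * (D * p - B * q) + D * w ^+ 2) +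
  ((2 * B)^-1 * (A * x ^+ 2 + 2 * x * p) + - (w / B * x))); last by field.
by rewrite !expiD /chirp; ring.
Qed.

Lemma normc_saft_integral u w : L1 u ->
  normc (saft_integral A B D p q u w) = K * normc (fourier (fun x => u x * chirp x) (w / B)).
Proof.
move=> lu; rewrite saft_integralE// !ComplexField.Normc.normcM normc_expi mulr1.
by rewrite normc_conjc.
Qed.

Lemma cmeasurable_saft_integral u : L1 u -> cmeasurable setT (saft_integral A B D p q u).
Proof.
move=> lu; rewrite (_ : saft_integral A B D p q u = (fun w => conjc (K_B B) *
  expi ((2 * B)^-1 * (- 2 * w * (D * p - B * q) + D * w ^+ 2)) *
  fourier (fun x => u x * chirp x) (w / B))); last by apply/funext => w; exact: saft_integralE.
apply: cmeasurableM.
  apply: cmeasurableM; first exact: cmeasurable_cst.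
  apply: cmeasurable_expi; apply: measurable_funM => //; apply: measurable_funD.
    by apply: measurable_funM => //; exact: measurable_funM.
  by apply: measurable_funM => //; exact: measurable_funX.
apply: (cmeasurableT_comp (f := fourier _)); last exact: measurable_funM.
apply: cmeasurable_fourier; exact: (cintegrable_cmeasurable (chirp_L1 lu)).
Qed.

Lemma saft_integralB u v w : L1 u -> L1 v ->
  saft_integral A B D p q (fun x => u x - v x) w =
  saft_integral A B D p q u w - saft_integral A B D p q v w.
Proof.
move=> lu lv; rewrite !saft_integralE//; last exact: cintegrableB.
rewrite -mulrBr; congr (_ * _); rewrite /fourier -cintegralB//.
- by apply: eq_cintegral => x _; ring.
- exact/cintegrable_fourier/chirp_L1.
- exact/cintegrable_fourier/chirp_L1.
Qed.

(* Applied to [Psi(., z)], this is the convolution kernel of the wavelet transform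
   at scale [z]. *)
Definition dilated_chirp (u : R -> R[i]) (z y : R) : R[i] := u (y / z) * chirp (y / z).

Section scale.
Variable z : R.
Hypothesis z0 : 0 < z.
Let zV : z^-1 != 0. Proof. by rewrite invr_eq0 gt_eqF. Qed.

Lemma dilated_chirp_L1 u : L1 u -> L1 (dilated_chirp u z).
Proof.
move=> lu; have := cintegrable_affine 0 zV (chirp_L1 lu).
by under [X in cintegrable _ _ X]eq_fun do rewrite addr0 (mulrC z^-1).
Qed.

Lemma dilated_chirp_L2 u : L2 u -> L2 (dilated_chirp u z).
Proof.
move=> lu; have := cLp2_affine 0 zV (chirp_L2 lu).
by under [X in cLp _ _ X]eq_fun do rewrite addr0 (mulrC z^-1).
Qed.

Lemma cLnorm_dilated_chirp u : cmeasurable setT u ->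
  (N2 (dilated_chirp u z) = (Num.sqrt z)%:E * N2 u)%E.
Proof.
move=> m_u; have mc := cmeasurableM m_u cmeasurable_chirp.
have := cLnorm2_affine 0 zV mc; rewrite cLnorm_chirp.
rewrite gtr0_norm ?invr_gt0// sqrtrV ?ltW// invrK => <-.
by apply: eq_cLnorm => y; rewrite addr0 (mulrC z^-1).
Qed.

Lemma dilated_chirpB u v y :
  dilated_chirp (fun x => u x - v x) z y = dilated_chirp u z y - dilated_chirp v z y.
Proof. by rewrite /dilated_chirp mulrBl. Qed.

Lemma fourier_dilated_chirp u xi : L1 u ->
  fourier (dilated_chirp u z) xi = z%:C * fourier (fun x => u x * chirp x) (z * xi).
Proof.
move=> lu; have := cintegral_affine 0 zV (cintegrable_fourier (z * xi) (chirp_L1 lu)).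
rewrite gtr0_norm ?invr_gt0// invrK => <-; apply: eq_cintegral => y _.
rewrite addr0 (mulrC z^-1) /dilated_chirp; congr (_ * expi (- _)).
by field; rewrite gt_eqF.
Qed.

Lemma normc_fourier_dilated_chirp u w : L1 u ->
  normc (saft_integral A B D p q u (z * w)) =
  K / z * normc (fourier (dilated_chirp u z) (w / B)).
Proof.
move=> lu; rewrite normc_saft_integral// fourier_dilated_chirp//.
rewrite ComplexField.Normc.normcM normc_real gtr0_norm// mulrA divfK ?gt_eqF//.
by rewrite mulrA.
Qed.

(** The convolution theorem and Plancherel, read at frequency [w / B]; the dilation by [z] turns the
    transform of [u] at [w / B] into its SAFT at [z * w]. *)
Lemma cLnorm_conv_dilated_chirp f u : L1 f -> L2 f -> L1 u -> L2 u ->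
  (N2 (convolution f (dilated_chirp u z)) =
   z%:E * N2 (fun w => fourier f (w / B) * saft_integral A B D p q u (z * w))%R)%E.
Proof.
move=> f1 f2 u1 u2; have v1 := dilated_chirp_L1 u1; have v2 := dilated_chirp_L2 u2.
set v := dilated_chirp u z in v1 v2 *.
have c1 : L1 (convolution f v) by exact: cintegrable_conv.
have c2 : L2 (convolution f v) by exact: cLp2_conv.
have mF := cmeasurable_fourier (cLp_measurable c2).
have BV : B^-1 != 0 by rewrite invr_eq0.
have K0 := normc_K_B_gt0.
have e1 : N2 (fun w => fourier (convolution f v) (B^-1 * w + 0)) =
    ((z / K)%:E * N2 (fun w => fourier f (w / B) * saft_integral A B D p q u (z * w))%R)%E.
  have mg : cmeasurable setT (fun w : R => fourier f (w / B) * saft_integral A B D p q u (z * w)).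
    apply: cmeasurableM.
      apply: (cmeasurableT_comp (f := fourier f)); last exact: measurable_funM.
      exact: cmeasurable_fourier (cLp_measurable f2).
    apply: (cmeasurableT_comp (f := saft_integral A B D p q u)); last exact: measurable_funM.
    exact: cmeasurable_saft_integral.
  rewrite -[(z / K)%:E](_ : (normc (z / K)%:C)%:E = _); last first.
    by rewrite normc_real gtr0_norm ?divr_gt0.
  rewrite -cLnorm2Z//; apply: eq_cLnorm => w; rewrite addr0 (mulrC B^-1) fourier_conv//.
  rewrite !ComplexField.Normc.normcM normc_fourier_dilated_chirp// normc_real.
  rewrite gtr0_norm ?divr_gt0//.
  by field; rewrite !gt_eqF.
have := cLnorm2_affine 0 BV mF; rewrite e1 plancherel// => e2.
have {}e2 := congr1 (fun y => (K%:E * y)%E) e2.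
move: e2; rewrite !muleA -!EFinM mulrCA mulfV ?gt_eqF// mulr1 => ->.
rewrite (_ : _ * _ * _ = 1) ?mul1e//.
(* The root of [2 * pi] from Plancherel and the root of [|B|] from the substitution are exactly
   [K^-1], so only [z] survives. *)
have -> : K = (Num.sqrt (2 * pi * `|B|))^-1.
  by rewrite -[LHS](ger0_norm (ltW K0)) -sqrtr_sqr normc_sqr_K_B sqrtrV ?mulr_ge0 ?pi_ge0.
rewrite normrV ?unitfE// sqrtrV// invrK sqrtrM ?mulr_ge0 ?pi_ge0//.
by field; rewrite !sqrtr_eq0 -!ltNge normr_gt0 B0 mulr_gt0 ?pi_gt0.
Qed.

Lemma cLp2_saft_integral u : L1 u -> L2 u -> L2 (saft_integral A B D p q u).
Proof.
move=> u1 u2; have BV : B^-1 != 0 by rewrite invr_eq0.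
have := cLp2_affine 0 BV (cLp2_fourier (chirp_L1 u1) (chirp_L2 u2)).
move/(@cLp2_le _ _ _ mu (saft_integral A B D p q u) _ K); apply.
  exact: cmeasurable_saft_integral.
by move=> w; rewrite normc_saft_integral// addr0 (mulrC B^-1).
Qed.

Lemma cLp2_scale (h : R -> R[i]) : L2 h -> L2 (fun w => h (z * w)).
Proof.
move=> lh; have := cLp2_affine 0 (lt0r_neq0 z0) lh.
by under [X in cLp _ _ X]eq_fun do rewrite addr0.
Qed.

Let M f := Rintegral mu setT (fun x => normc (f x)).

Let cmeasurable_fourier_div f : L1 f -> cmeasurable setT (fun w : R => fourier f (w / B)).
Proof.
move=> f1; apply: (cmeasurableT_comp (f := fourier f)); last exact: measurable_funM.
exact: cmeasurable_fourier (cintegrable_cmeasurable f1).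
Qed.

Lemma cLp2_fourier_mul f h : L1 f -> L2 h -> L2 (fun w => fourier f (w / B) * h (z * w)).
Proof.
move=> f1 lh; have lz := cLp2_scale lh.
apply: (cLp2_le (M := M f) lz).
  by apply: cmeasurableM; [exact: cmeasurable_fourier_div|case: lz].
move=> w; rewrite ComplexField.Normc.normcM ler_wpM2r ?normc_ge0//.
exact: normc_fourier_le.
Qed.

Lemma cLnorm_fourier_mul_le f h : L1 f -> L2 h ->
  (N2 (fun w => fourier f (w / B) * h (z * w))%R <= (M f / Num.sqrt z)%:E * N2 h)%E.
Proof.
move=> f1 lh; have lz := cLp2_scale lh.
have M0 : 0 <= M f by apply: Rintegral_ge0 => x _; exact: normc_ge0.
have := cLnorm2_affine 0 (lt0r_neq0 z0) lh.1; rewrite gtr0_norm// => e.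
rewrite EFinM -muleA -e; apply: (@le_trans _ _ (N2 (fun w => (M f)%:C * h (z * w + 0))%R)); last first.
  rewrite cLnorm2Z ?normc_real ?ger0_norm//.
  exact: (cLp2_affine 0 (lt0r_neq0 z0) lh).1.
apply: le_cLnorm2.
- exact: (cLp2_fourier_mul f1 lh).1.
- apply: cmeasurableM; first exact: cmeasurable_cst.
  exact: (cLp2_affine 0 (lt0r_neq0 z0) lh).1.
- move=> w; rewrite addr0 !ComplexField.Normc.normcM normc_real (ger0_norm M0).
  by rewrite ler_wpM2r ?normc_ge0//; exact: normc_fourier_le.
Qed.

(** Passes from the approximants in [is_saft] to their limit. The convolutions converge at every
    point, and the products converge in L^2 because the transform of the integrable [f] is
    bounded. *)
Lemma cLnorm_convolution_is_saft f g H : L1 f -> L2 f -> is_saft A B D p q g H ->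
  (N2 (convolution f (dilated_chirp g z)) =
   z%:E * N2 (fun w => fourier f (w / B) * H (z * w))%R)%E.
Proof.
move=> f1 f2 [g2 H2 [u [u12 ug uH]]].
have u1 n : L1 (u n) by apply/cLp1P; case: (u12 n).
have u2 n : L2 (u n) by case: (u12 n).
have v2 n := dilated_chirp_L2 (u2 n); have vg2 := dilated_chirp_L2 g2.
have s2 n := cLp2_saft_integral (u1 n) (u2 n).
apply: (@cLnorm2_pointwise_isometry _ _ _ _ R mu mu
  (fun n => convolution f (dilated_chirp (u n) z)) _
  (fun n w => fourier f (w / B) * saft_integral A B D p q (u n) (z * w))).
- by move=> n; apply: cmeasurable_conv; [case: f2|case: (v2 n)].
- by apply: cmeasurable_conv; [case: f2|case: vg2].
- move=> t; rewrite /convolution.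
  have e h : cintegral mu setT (fun x => f x * h (t - x)) =
    cintegral mu setT (fun x => h (t - x) * f x) by apply: eq_cintegral => x _; rewrite mulrC.
  rewrite e /ccvg; under eq_fun do rewrite e.
  refine (@cLp_cvg_cintegral _ _ R mu (fun n x => dilated_chirp (u n) z (t - x))
    (fun x => dilated_chirp g z (t - x)) f _ _ f2 _).
  + by move=> n; exact: cLp2_reflect.
  + exact: cLp2_reflect.
  (* Dilation scales every error norm by the root of [z], and reflection about [t] preserves it. *)
  + rewrite /cLp_cvg (_ : (fun n => _) = (fun n => (Num.sqrt z)%:E * N2 (fun x => u n x - g x)%R)%E).
      by rewrite -(mule0 (Num.sqrt z)%:E); apply: cvgeZl.
    apply/funext => n; rewrite -cLnorm_dilated_chirp; last exact: (cLp2B (u2 n) g2).1.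
    rewrite -(cLnorm2_reflect t (cLp_measurable (dilated_chirp_L2 (cLp2B (u2 n) g2)))).
    by apply: eq_cLnorm => x; rewrite dilated_chirpB.
- by move=> n; exact: cLp2_fourier_mul.
- exact: cLp2_fourier_mul.
- have h : (fun n => (M f / Num.sqrt z)%:E * N2 (fun w => saft_integral A B D p q (u n) w - H w)%R)%E
      @ \oo --> (0 : \bar R).
    by rewrite -(mule0 (M f / Num.sqrt z)%:E); apply: cvgeZl.
  apply: (squeeze_cvge _ (cvg_cst 0%E) h); apply: nearW => n; rewrite cLnorm_ge0 /=.
  apply: le_trans (cLnorm_fourier_mul_le f1 (cLp2B (s2 n) H2)).
  by rewrite le_eqVlt; apply/orP; left; apply/eqP/eq_cLnorm => w; rewrite mulrBr.
- exact: ltW.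
- by move=> n; exact: cLnorm_conv_dilated_chirp.
- move=> n m; have b1 := cintegrableB measurableT (u1 n) (u1 m).
  have := cLnorm_conv_dilated_chirp f1 f2 b1 (cLp2B (u2 n) (u2 m)).
  rewrite (@eq_cLnorm _ _ _ mu 2%:E (convolution _ _) (fun t =>
    convolution f (dilated_chirp (u n) z) t - convolution f (dilated_chirp (u m) z) t)).
    move=> ->; congr (_ * _)%E; apply: eq_cLnorm => w.
    by rewrite saft_integralB// mulrBr.
  move=> t; congr normc; rewrite /convolution -cintegralB//.
  + by apply: eq_cintegral => x _; rewrite dilated_chirpB mulrBr.
  + by apply: cintegrable_mul => //; exact: cLp2_reflect.
  + by apply: cintegrable_mul => //; exact: cLp2_reflect.
Qed.

End scale.

(** The factors [zeta^2 - 1] and [zeta - 1] in [Psi] are made for this: with [y = (t - x) / z], the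
    phase of [Psi] at [y] plus the chirp phase at [y] is the chirp phase at [t - x]. *)
Lemma sawtE f psi t z : L2 f -> L2 (fun x => Psi A B p psi x z) -> 0 < z ->
  sawt A B psi f t z = conjc (chirp t) * (conjc (K_B B) * ((Num.sqrt z)^-1)%:C) *
    convolution (fun x => f x * chirp x) (dilated_chirp (fun x => Psi A B p psi x z) z) t.
Proof.
move=> lf lP z0; rewrite /sawt /convolution -cintegralZ//; last first.
  apply: cintegrable_mul; first exact: chirp_L2.
  by apply: cLp2_reflect; exact: dilated_chirp_L2.
apply: eq_cintegral => x _.
(* The terms in [p] cancel, and [x^2 - t^2 + (t - x)^2 = - 2 x (t - x)] accounts for those in
   [A]. *)
have e1 : - (A * x * (t - x) / B) = - ((2 * B)^-1 * (A * t ^+ 2 + 2 * t * p)) +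
    ((2 * B)^-1 * (A * x ^+ 2 + 2 * x * p) +
    ((2 * B)^-1 * (A * ((t - x) / z) ^+ 2 * (z ^+ 2 - 1) + 2 * ((t - x) / z) * p * (z - 1)) +
    ((2 * B)^-1 * (A * ((t - x) / z) ^+ 2 + 2 * ((t - x) / z) * p)))).
  by field; rewrite B0 gt_eqF.
have e2 : - ((t - x) / z) = (x - t) / z by rewrite -mulNr opprB.
have e3 : K_B B / (Num.sqrt z)%:C = K_B B * ((Num.sqrt z)^-1)%:C by rewrite fmorphV.
rewrite /sa_wavelet e3 !conjcM -expiN e1 !expiD expiN conjc_real.
rewrite /dilated_chirp /Psi e2 -/(chirp t) -/(chirp x) -/(chirp _).
by ring.
Qed.

End saft_fourier.

(** * Polarization of L^2 pairings *)

Section polarization.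
Context (d : measure_display) (T : measurableType d) (R : realType).
Variable mu : {measure set T -> \bar R}.

(** Real-valued, so that energies can be subtracted freely. *)
Definition energy (f : T -> R[i]) : R := Rintegral mu setT (fun x => normc (f x) ^+ 2).

Lemma integrable_normc_sqr (f : T -> R[i]) : cLp mu 2%:E f ->
  mu.-integrable setT (fun x => (normc (f x) ^+ 2)%:E).
Proof.
move=> /cLp2P[mf fy]; apply/integrableP; split; first exact: measurable_normc_sqrE.
by under eq_integral do rewrite /= ger0_norm ?sqr_ge0//.
Qed.

Lemma energyE (f : T -> R[i]) : cLp mu 2%:E f ->
  (energy f)%:E = (cLnorm mu 2%:E f * cLnorm mu 2%:E f)%E.
Proof.
move=> lf; rewrite sqr_cLnorm2 /energy /Rintegral fineK//.
exact: integrable_fin_num (integrable_normc_sqr lf).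
Qed.

Lemma cLp2_linear (f g : T -> R[i]) (c : R[i]) : cLp mu 2%:E f -> cLp mu 2%:E g ->
  cLp mu 2%:E (fun x => f x + c * g x).
Proof.
move=> lf lg; apply: cLp2D => //; apply: (cLp2_le (M := normc c) lg).
  by apply: cmeasurableM; [exact: cmeasurable_cst|case: lg].
by move=> x; rewrite ComplexField.Normc.normcM.
Qed.

(** All four combinations keep the shape [f + c * g], even for [c = 1], so that linearity of the
    transform rewrites them uniformly. *)
Lemma cintegral_polarization (f g : T -> R[i]) : cLp mu 2%:E f -> cLp mu 2%:E g ->
  4%:R * cintegral mu setT (fun x => f x * conjc (g x)) =
  (energy (fun x => f x + 1 * g x) - energy (fun x => f x + -1 * g x)) +i*
  (energy (fun x => f x + 'i * g x) - energy (fun x => f x + - 'i * g x)).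
Proof.
move=> lf lg; rewrite -cintegralZ//; last by apply: cintegrable_mul => //; exact: cLp2J.
have ic c := integrable_normc_sqr (cLp2_linear c lf lg).
rewrite /cintegral /energy -!RintegralB//; try exact: ic.
congr (_ +i* _); apply: eq_Rintegral => x _; rewrite normc_polarization /=.
  by rewrite mul1r mulN1r.
by rewrite mulNr.
Qed.

End polarization.

(** * The wavelet transform on the plane and its isometry *)

Section wavelet_transform.
Context (R : realType).
Local Notation mu := (@lebesgue_measure R).
Local Notation nu := (@lebesgue_measure R \x @lebesgue_measure R)%E.
Local Notation L1 f := (cintegrable mu setT f).
Local Notation L2 f := (cLp mu 2%:E f).
Local Notation N2 f := (cLnorm mu 2%:E f).
Local Notation RR := (measurableTypeR R * measurableTypeR R)%type.
Variables (A B D p q : R) (psi : R -> R[i]).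
Implicit Types (f g : R -> R[i]).
Hypotheses (B0 : B != 0) (lpsi : L2 psi).

Lemma measurable_half_plane : measurable (half_plane R).
Proof.
rewrite (_ : half_plane R = snd @^-1` `]0, +oo[%classic); last first.
  by apply/seteqP; split => u; rewrite /half_plane /= in_itv/= andbT.
rewrite -[X in measurable X]setTI; exact: measurable_snd.
Qed.

(* The transform divided by the scale, extended by 0 outside the half plane:
   its energy on the whole plane carries the weight of [dt dz / z^2]. *)
Definition scale_inv (z : R) : R := if 0 < z then z^-1 else 0.

Definition wavelet_plane f (u : RR) : R[i] :=
  sawt A B psi f u.1 u.2 * (scale_inv u.2)%:C.

Lemma measurable_scale_inv : measurable_fun setT scale_inv.
Proof.
apply: measurable_fun_ifT => //; first exact: measurable_fun_ltr.
exact: measurable_invr.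
Qed.

Lemma cmeasurable_wavelet_plane f : cmeasurable setT f -> cmeasurable setT (wavelet_plane f).
Proof.
move=> mf; apply: cmeasurableM; last first.
  apply: cmeasurable_realC; apply: (measurableT_comp measurable_scale_inv).
  exact: measurable_snd.
apply: (@cmeasurable_cintegral_param _ _ RR (measurableTypeR R) R mu
  (fun v => f v.2 * conjc (sa_wavelet A B psi v.1.1 v.1.2 v.2))).
have m11 : measurable_fun setT (fun v : RR * measurableTypeR R => v.1.1).
  by apply: measurableT_comp.
have m12 : measurable_fun setT (fun v : RR * measurableTypeR R => v.1.2).
  by apply: measurableT_comp.
apply: cmeasurableM; first exact: (cmeasurableT_comp mf).
apply: cmeasurableJ; rewrite /sa_wavelet; apply: cmeasurableM.
  apply: cmeasurableM.
    apply: cmeasurableM; first exact: cmeasurable_cst.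
    under [X in cmeasurable _ X]eq_fun do rewrite -fmorphV.
    apply: cmeasurable_realC; apply: (measurableT_comp (@measurable_invr R)).
    exact: (measurableT_comp (@measurable_sqrtr R)).
  apply: (cmeasurableT_comp lpsi.1); apply: measurable_funM; first exact: measurable_funB.
  exact: (measurableT_comp (@measurable_invr R)).
apply: cmeasurable_expi; apply: measurable_funM => //.
by apply: measurable_funM; [exact: measurable_funM|exact: measurable_funB].
Qed.

Lemma cLp2_sa_wavelet t z : 0 < z -> L2 (sa_wavelet A B psi t z).
Proof.
move=> z0; have zV : z^-1 != 0 by rewrite invr_eq0 gt_eqF.
have l1 : L2 (fun x => psi ((x - t) / z)).
  have := cLp2_affine (- (z^-1 * t)) zV lpsi.
  by under [X in cLp _ _ X]eq_fun do rewrite -mulrBr mulrC.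
apply: (cLp2_le (M := normc (K_B B / (Num.sqrt z)%:C)) l1).
  rewrite /sa_wavelet; apply: cmeasurableM.
    by apply: cmeasurableM; [exact: cmeasurable_cst|case: l1].
  apply: cmeasurable_expi; apply: measurable_funM => //.
  by apply: measurable_funM; [exact: measurable_funM|exact: measurable_funB].
by move=> x; rewrite /sa_wavelet !ComplexField.Normc.normcM normc_expi mulr1.
Qed.

(** At positive scales the pairings with the wavelet are integrable; at the other scales [scale_inv]
    makes both sides vanish. *)
Lemma wavelet_plane_linear f g (c : R[i]) (u : RR) : L2 f -> L2 g ->
  wavelet_plane (fun x => f x + c * g x) u = wavelet_plane f u + c * wavelet_plane g u.
Proof.
move=> lf lg; rewrite /wavelet_plane /scale_inv; case: ifPn => u2; last by rewrite !mulr0 addr0.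
have lw := cLp2J (cLp2_sa_wavelet u.1 u2).
rewrite mulrA -mulrDl; congr (_ * _); rewrite /sawt.
have ig := cintegrable_mul lg lw; have if_ := cintegrable_mul lf lw.
rewrite -cintegralZ// -cintegralD//; last exact: cintegrableZ.
by apply: eq_cintegral => x _; ring.
Qed.

Lemma wavelet_plane_cvg (s : nat -> R -> R[i]) f (u : RR) : (forall n, L2 (s n)) -> L2 f ->
  cLp_cvg mu 2%:E s f -> ccvg (fun n => wavelet_plane (s n) u) (wavelet_plane f u).
Proof.
move=> ls lf sf; rewrite /wavelet_plane /scale_inv.
case: ifPn => u2; last first.
  rewrite /ccvg; under eq_fun do rewrite !mulr0 subr0 ComplexField.Normc.normc0.
  exact: cvg_cst.
have lw := cLp2J (cLp2_sa_wavelet u.1 u2).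
have := cLp_cvg_cintegral ls lf lw sf; rewrite /ccvg => h.
under eq_fun do rewrite -mulrBl ComplexField.Normc.normcM.
rewrite -(mul0r (normc (u.2^-1)%:C)); apply: cvgM; last exact: cvg_cst.
exact: h.
Qed.

Variables (Cpsi : R) (H : R -> R -> R[i]).
Hypotheses (C0 : 0 < Cpsi) (mH : cmeasurable (half_plane R) (fun u => H u.1 u.2))
  (HP : forall z : R, 0 < z ->
    is_saft A B D p q (fun x => Psi A B p psi x z) (H ^~ z))
  (HC : {ae mu, forall w : R,
    (\int[mu]_(z in `]0%R, +oo[) (normc (H (z * w) z) ^+ 2 / z)%:E = Cpsi%:E)%E}).

Let K := normc (K_B B).

(** The constant is [(K / sqrt z)^2] from [sawtE] times the [z^2] of the convolution identity. *)
Lemma integral_sqr_sawt f z : L1 f -> L2 f -> 0 < z ->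
  (\int[mu]_t (normc (sawt A B psi f t z) ^+ 2)%:E =
   (K ^+ 2 * z)%:E * \int[mu]_w
     (normc (fourier (fun x => f x * chirp A B p x)%R (w / B) * H (z * w) z) ^+ 2)%:E)%E.
Proof.
move=> f1 f2 z0; have HPz := HP z0.
have e := cLnorm_convolution_is_saft B0 z0 (chirp_L1 A B p f1) (chirp_L2 A B p f2) HPz.
have lP : L2 (fun x => Psi A B p psi x z) by case: HPz.
have sz0 : 0 < Num.sqrt z by rewrite sqrtr_gt0.
rewrite -!sqr_cLnorm2.
have -> : N2 (fun t => sawt A B psi f t z) =
    ((K / Num.sqrt z)%:E * N2 (convolution (fun x => f x * chirp A B p x)%R
      (dilated_chirp A B p (fun x => Psi A B p psi x z) z)))%E.
  have K0 : 0 < K by exact: normc_K_B_gt0.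
  rewrite -[(K / Num.sqrt z)%:E](_ : (normc (K / Num.sqrt z)%:C)%:E = _); last first.
    by rewrite normc_real gtr0_norm ?divr_gt0.
  rewrite -cLnorm2Z; last first.
    apply: cmeasurable_conv; first by case: (chirp_L2 A B p f2).
    by case: (dilated_chirp_L2 A B p z0 lP).
  apply: eq_cLnorm => t; rewrite (sawtE (p := p) B0)// !ComplexField.Normc.normcM.
  rewrite !normc_conjc normc_chirp mul1r !normc_real (gtr0_norm (divr_gt0 K0 sz0)).
  by rewrite gtr0_norm ?invr_gt0.
rewrite e (muleA _ z%:E) -EFinM muleACA -EFinM; congr (_%:E * _)%E.
rewrite -[z in K / _ * z]sqr_sqrtr ?(ltW z0)// -[in RHS](sqr_sqrtr (ltW z0)).
by field; rewrite gt_eqF.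
Qed.

(** Tonelli is used twice: [t] is integrated first at fixed scale, which introduces the frequency
    [w]; the order of [w] and [z] is then exchanged, so that admissibility evaluates the integral
    over the scale. *)
Lemma integral_sqr_wavelet_plane f : L1 f -> L2 f ->
  (\int[nu]_u (normc (wavelet_plane f u) ^+ 2)%:E =
   Cpsi%:E * \int[mu]_x (normc (f x) ^+ 2)%:E)%E.
Proof.
move=> f1 f2; set F := fourier (fun x => f x * chirp A B p x).
have mX := measurable_normc_sqrE (cmeasurable_wavelet_plane f2.1).
rewrite fubini_tonelli2//; last by move=> u; rewrite lee_fin sqr_ge0.
(* The weight [z^-2] times the factor [z] of [integral_sqr_sawt] leaves one [z^-1]. *)
pose g (v : RR) : R := normc (H (v.2 * v.1) v.2) ^+ 2 * scale_inv v.2.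
have g0 v : 0 <= g v.
  by rewrite mulr_ge0 ?sqr_ge0// /scale_inv; case: ifP => // /ltW; rewrite invr_ge0.
(* [H] is measurable only on the half plane; its extension by 0 gives joint measurability of [g] on
   the plane. *)
pose Hr (u : RR) : R[i] := ((fun u => complex.Re (H u.1 u.2)) \_ (half_plane R)) u +i*
  ((fun u => complex.Im (H u.1 u.2)) \_ (half_plane R)) u.
have HrE w z : 0 < z -> Hr (w, z) = H w z.
  by move=> z0; rewrite /Hr /patch !mem_set//=; case: (H w z).
have mHr : cmeasurable setT Hr.
  by split; apply/(measurable_restrictT _ measurable_half_plane); case: mH.
have gE : g = fun v => normc (Hr (v.2 * v.1, v.2)) ^+ 2 * scale_inv v.2.
  apply/funext => v; rewrite /g /scale_inv; case: ifP => v2; last by rewrite !mulr0.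
  by rewrite HrE.
have mg : measurable_fun setT g.
  rewrite gE; apply: measurable_funM; last exact: (measurableT_comp measurable_scale_inv).
  apply: measurable_normc_sqr; apply: (cmeasurableT_comp (f := Hr)) => //.
  by apply: measurable_fun_pair => //; exact: measurable_funM.
have F1 := chirp_L1 A B p f1; have F2 := chirp_L2 A B p f2.
have mFB : cmeasurable setT (fun w : R => F (w / B)).
  apply: (cmeasurableT_comp (f := F)); last exact: measurable_funM.
  exact: cmeasurable_fourier (cLp_measurable F2).
have mF : measurable_fun setT (fun w : R => K ^+ 2 * normc (F (w / B)) ^+ 2).
  by apply: measurable_funM => //; exact: measurable_normc_sqr.
have mFg : measurable_fun setT
    (fun v : RR => (K ^+ 2 * normc (F (v.1 / B)) ^+ 2 * g v)%:E).
  apply: measurableEFin; apply: measurable_funM => //.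
  exact: (measurableT_comp mF).
have F0 v : 0 <= K ^+ 2 * normc (F (v / B)) ^+ 2 by rewrite mulr_ge0 ?sqr_ge0.
have Fg0 (v : RR) : (0 <= (K ^+ 2 * normc (F (v.1 / B)) ^+ 2 * g v)%:E)%E.
  by rewrite lee_fin mulr_ge0.
transitivity (\int[mu]_z \int[mu]_w (K ^+ 2 * normc (F (w / B)) ^+ 2 * g (w, z))%:E)%E.
  apply: eq_integral => z _; rewrite /fubini_G.
  have [z0|z0] := ltP 0 z; last first.
    rewrite !integral0_eq// => x _; rewrite /g /wavelet_plane /scale_inv ltNge z0.
      by rewrite !mulr0.
    by rewrite mulr0 ComplexField.Normc.normc0 expr0n.
  have ms : cmeasurable setT (fun t => sawt A B psi f t z).
    rewrite (_ : (fun t => _) = (fun t : R => wavelet_plane f (t, z) * z%:C)).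
      apply: cmeasurableM; last exact: cmeasurable_cst.
      apply: (cmeasurableT_comp (cmeasurable_wavelet_plane f2.1)).
      exact: measurable_pair2.
    apply/funext => t; rewrite /wavelet_plane /scale_inv /= z0 -mulrA -rmorphM /=.
    by rewrite mulVf ?gt_eqF// mulr1.
  transitivity (\int[mu]_t ((z^-1 ^+ 2)%:E * (normc (sawt A B psi f t z) ^+ 2)%:E))%E.
    apply: eq_integral => t _; rewrite /wavelet_plane /scale_inv z0.
    rewrite ComplexField.Normc.normcM normc_real exprMn -EFinM mulrC.
    by rewrite real_normK// num_real.
  rewrite ge0_integralZl_EFin ?sqr_ge0//; last 2 first.
  - by move=> t _; rewrite lee_fin sqr_ge0.
  - exact: measurable_normc_sqrE.
  rewrite integral_sqr_sawt// muleA -EFinM.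
  rewrite -ge0_integralZl_EFin//; last 3 first.
  - by move=> w _; rewrite lee_fin sqr_ge0.
  - have [_ lH _] := HP z0; apply: measurable_normc_sqrE.
    exact: (cLp2_fourier_mul B z0 F1 lH).1.
  - by rewrite mulr_ge0 ?sqr_ge0// mulr_ge0 ?sqr_ge0// (ltW z0).
  have gE' w : g (w, z) = normc (H (z * w) z) ^+ 2 / z by rewrite /g /scale_inv /= z0.
  apply: eq_integral => w _; rewrite -EFinM gE' ComplexField.Normc.normcM -/F.
  congr (_%:E); by field; rewrite gt_eqF.
rewrite -(fubini_tonelli (fun v : RR => (K ^+ 2 * normc (F (v.1 / B)) ^+ 2 * g v)%:E))//.
(* Admissibility holds for almost every [w] only, hence an almost everywhere comparison of the outer
   integrands. *)
transitivity (\int[mu]_w ((K ^+ 2 * normc (F (w / B)) ^+ 2)%:E * Cpsi%:E))%E.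
  apply: ge0_ae_eq_integral => //.
  - exact: (measurable_fun_fubini_tonelli_F _ mFg Fg0).
  - by apply: emeasurable_funM => //; exact: measurableEFin.
  - by move=> w _; apply: integral_ge0 => z _; exact: Fg0.
  - by move=> w _; rewrite -EFinM lee_fin mulr_ge0// ltW.
  apply: (negligibleS _ HC) => w; apply: contra_not => Hw _.
  have mgw : measurable_fun setT (fun z => (g (w, z))%:E).
    apply: measurableEFin; apply: (measurableT_comp mg); exact: measurable_pair1.
  transitivity ((K ^+ 2 * normc (F (w / B)) ^+ 2)%:E * \int[mu]_z (g (w, z))%:E)%E.
    by rewrite -ge0_integralZl_EFin ?F0//; move=> z _; rewrite lee_fin.
  congr (_ * _)%E; rewrite -Hw [RHS]integral_mkcond; apply: eq_integral => z _.
  rewrite /g /scale_inv /patch /= mem_setE in_itv/= andbT.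
  by case: ifP => _; rewrite ?mulr0.
rewrite ge0_integralZr//; last 3 first.
- exact: measurableEFin.
- by move=> w _; rewrite lee_fin.
- by rewrite lee_fin ltW.
rewrite muleC; congr (_ * _)%E.
have BV : B^-1 != 0 by rewrite invr_eq0.
have mF2 : measurable_fun setT (fun w : R => (normc (F w) ^+ 2)%:E).
  apply: measurable_normc_sqrE; exact: cmeasurable_fourier (cLp_measurable F2).
have F20 (w : R) : (0 <= (normc (F w) ^+ 2)%:E)%E by rewrite lee_fin sqr_ge0.
have e : (\int[mu]_w (normc (F (w / B)) ^+ 2)%:E =
    `|B^-1|^-1%:E * \int[mu]_w (normc (F w) ^+ 2)%:E)%E.
  rewrite -(ge0_integral_affine 0 BV mF2 F20); apply: eq_integral => w _.
  by rewrite addr0 (mulrC B^-1).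
transitivity ((K ^+ 2)%:E * \int[mu]_w (normc (F (w / B)) ^+ 2)%:E)%E.
  rewrite -ge0_integralZl_EFin ?sqr_ge0//.
  exact: measurable_normc_sqrE.
rewrite e (plancherel_energy F1 F2) !muleA -!EFinM normc_sqr_K_B// normrV ?unitfE// invrK.
rewrite (_ : _ * _ * _ = 1) ?mul1e; last first.
  by rewrite -mulrA (mulrC `|B|) mulVf// !mulf_neq0 ?normr_eq0// gt_eqF// pi_gt0.
by apply: eq_integral => x _; rewrite ComplexField.Normc.normcM normc_chirp mulr1.
Qed.

Lemma cLnorm_wavelet_plane_L1 f : L1 f -> L2 f ->
  (cLnorm nu 2%:E (wavelet_plane f) = (Num.sqrt Cpsi)%:E * N2 f)%E.
Proof.
move=> f1 f2; rewrite !cLnorm2E integral_sqr_wavelet_plane// poweRM ?lee_fin ?(ltW C0)//.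
  by rewrite poweR_EFin powR12_sqrt// ltW.
by apply: integral_ge0 => x _; rewrite lee_fin sqr_ge0.
Qed.

Lemma cLnorm_wavelet_plane f : L2 f ->
  (cLnorm nu 2%:E (wavelet_plane f) = (Num.sqrt Cpsi)%:E * N2 f)%E.
Proof.
(* Truncation to a bounded interval is a product of two L^2 functions, hence integrable. *)
move=> lf; pose s n x : R[i] := f x * (\1_(`[- n%:R, n%:R]%classic) x : R)%:C.
have sE n x : s n x = if `|x| <= n%:R then f x else 0.
  by rewrite /s indic_itvNN; case: ifP => _; rewrite ?mulr1 ?mulr0.
have s1 n : L1 (s n) by apply: cintegrable_mul => //; exact: cLp2_indic_itv.
have s2 n : L2 (s n).
  apply: (cLp2_le (M := 1) lf); first exact: cintegrable_cmeasurable (s1 n).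
  by move=> x; rewrite mul1r sE; case: ifP; rewrite ?ComplexField.Normc.normc0 ?normc_ge0.
have sf : cLp_cvg mu 2%:E s f.
  apply: (cLp_cvg_dominated _ lf.1 lf); first by move=> n; case: (s2 n).
    move=> n x; rewrite sE; case: ifP => _; rewrite ?subrr ?sub0r ?normcN//.
    by rewrite ComplexField.Normc.normc0 normc_ge0.
  move=> x; apply/cvgr0Pnorm_le => eps eps0.
  near=> n.
  have xn : `|(x : R)| <= n%:R by near: n; exact: nbhs_infty_ger.
  by rewrite sE xn subrr ComplexField.Normc.normc0 normr0 ltW.
apply: (@cLnorm2_pointwise_isometry _ _ _ _ R mu nu (fun n => wavelet_plane (s n)) _ s) => //.
- by move=> n; apply: cmeasurable_wavelet_plane; case: (s2 n).
- by apply: cmeasurable_wavelet_plane; case: lf.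
- by move=> u; exact: wavelet_plane_cvg.
- by move=> n; exact: cLnorm_wavelet_plane_L1.
- move=> n m.
  have e : (fun t => wavelet_plane (s n) t - wavelet_plane (s m) t) =
      wavelet_plane (fun x => s n x - s m x).
    have -> : (fun x => s n x - s m x) = (fun x => s n x + -1 * s m x).
      by apply/funext => x; rewrite mulN1r.
    by apply/funext => u; rewrite wavelet_plane_linear// mulN1r.
  rewrite e; apply: cLnorm_wavelet_plane_L1; last exact: cLp2B.
  by apply: cintegrableB.
Unshelve. all: by end_near. Qed.

Lemma cLp2_wavelet_plane f : L2 f -> cLp nu 2%:E (wavelet_plane f).
Proof.
move=> lf; split; first by apply: cmeasurable_wavelet_plane; case: lf.
rewrite cLnorm_wavelet_plane// lte_mul_pinfty ?lee_fin ?sqrtr_ge0//.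
by case: lf.
Qed.

Lemma energy_wavelet_plane f : L2 f -> energy nu (wavelet_plane f) = Cpsi * energy mu f.
Proof.
move=> lf; apply: EFin_inj; rewrite EFinM !energyE//; last exact: cLp2_wavelet_plane.
rewrite cLnorm_wavelet_plane// muleACA -EFinM -expr2 sqr_sqrtr ?(ltW C0)//.
Qed.

(** After multiplication by 4 both sides polarize, and linearity turns each energy on the plane into
    [Cpsi] times the matching energy on the line. *)
Lemma cintegral_wavelet_plane f g : L2 f -> L2 g ->
  cintegral nu setT (fun u => wavelet_plane f u * conjc (wavelet_plane g u)) =
  Cpsi%:C * inner_L2 f g.
Proof.
move=> lf lg; have n4 : 4%:R != 0 :> R[i] by rewrite pnatr_eq0.
apply: (mulfI n4); rewrite mulrCA.
rewrite (cintegral_polarization (cLp2_wavelet_plane lf) (cLp2_wavelet_plane lg)).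
rewrite /inner_L2 (cintegral_polarization lf lg).
have e (c : R[i]) : energy nu (fun u => wavelet_plane f u + c * wavelet_plane g u) =
    Cpsi * energy mu (fun x => f x + c * g x).
  rewrite -energy_wavelet_plane; last exact: cLp2_linear.
  by congr (energy nu); apply/funext => u; rewrite wavelet_plane_linear.
rewrite !e -!mulrBr; apply/eqP; rewrite eq_complex /= !mul0r subr0 addr0.
by rewrite !eqxx.
Qed.

End wavelet_transform.

Theorem theorem3p3 (R : realType) (A B C D p q : R)
    (hdet : A * D - B * C = 1) (hB : B != 0)
    (psi : R -> R[i]) (hpsi : cLp (@lebesgue_measure R) 2%:E psi)
    (Cpsi : R) (hadm : admissible A B D p q psi Cpsi)
    (f g : R -> R[i])
    (hf : cLp (@lebesgue_measure R) 2%:E f)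
    (hg : cLp (@lebesgue_measure R) 2%:E g) :
  let nu := (@lebesgue_measure R \x @lebesgue_measure R)%E in
  let integrand (tz : measurableTypeR R * measurableTypeR R) : R[i] :=
    sawt A B psi f tz.1 tz.2 * conjc (sawt A B psi g tz.1 tz.2)
      / ((tz.2 : R) ^+ 2)%:C in
  cintegrable nu (half_plane R) integrand /\
  cintegral nu (half_plane R) integrand = Cpsi%:C * inner_L2 f g.
Proof.
move=> nu integrand; case: hadm => C0 [H [mH HP HC]].
rewrite -(cintegral_wavelet_plane hB hpsi C0 mH HP HC hf hg) -/nu.
have lf := cLp2_wavelet_plane hB hpsi C0 mH HP HC hf.
have lg := cLp2_wavelet_plane hB hpsi C0 mH HP HC hg.
have [ir ii] := cintegrable_mul lf (cLp2J lg).
(* [X] equals the weighted integrand on the half plane and vanishes off it, so integrability and the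
   integral transfer from the plane. *)
pose X u := wavelet_plane A B psi f u * conjc (wavelet_plane A B psi g u).
have XE u : u \in half_plane R -> integrand u = X u.
  rewrite inE /half_plane /= => u0; rewrite /X /wavelet_plane /scale_inv u0.
  rewrite conjcM conjc_real mulrACA -rmorphM /= -invfM -expr2 /integrand.
  by rewrite -fmorphV.
have X0 u : u \notin half_plane R -> X u = 0.
  rewrite notin_setE /half_plane /= => /negP u0; rewrite /X /wavelet_plane /scale_inv (negbTE u0).
  by rewrite mulr0 mul0r.
split.
  have mh := @measurable_half_plane R.
  split; [apply: (eq_integrable mh _ _ _ (integrableS measurableT mh (@subsetT _ _) ir))|
    apply: (eq_integrable mh _ _ _ (integrableS measurableT mh (@subsetT _ _) ii))] => u uh.
    by rewrite XE.
  by rewrite XE.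
by rewrite /cintegral; congr (_ +i* _); rewrite [LHS]Rintegral_mkcond;
  apply: eq_Rintegral => u _; rewrite patchE -/(X u); case: ifPn => [/XE ->|/X0 ->].
Qed.
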